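(* Let $(\mathcal{A},\varphi)$ be a non-commutative probability space with unit $\mathbf{1}_{\mathcal{A}}$. Let $\mathfrak{p}\in\mathcal{A}$ be a free Poisson variable with rate $\lambda>0$ and jump size $\alpha>0$, let $\mathfrak{b}\in\mathcal{A}$ be a Bernoulli variable with parameter $p\in(0,1)$, and suppose that $\mathfrak{p}$ and $\mathfrak{b}$ are freely independent. (a) If $\lambda=1$, then $\mathfrak{p}\mathfrak{b}$ and $\mathfrak{p}(\mathbf{1}_{\mathcal{A}}-\mathfrak{b})$ are freely independent; $\mathfrak{p}\mathfrak{b}$ is free Poisson with rate $p$ and $\mathfrak{p}(\mathbf{1}_{\mathcal{A}}-\mathfrak{b})$ is free Poisson with rate $1-p$. (b) If $\lambda\neq1$, then neither $\mathfrak{p}\mathfrak{b}$ nor $\mathfrak{p}(\mathbf{1}_{\mathcal{A}}-\mathfrak{b})$ is free Poisson (for any rate and jump size), and $\mathfrak{p}\mathfrak{b}$ and $\mathfrak{p}(\mathbf{1}_{\mathcal{A}}-\mathfrak{b})$ are not freely independent.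
   Context: A non-commutative probability space is a pair $(\mathcal{A},\varphi)$ with $\mathcal{A}$ a unital algebra over $\mathbb{C}$ and $\varphi:\mathcal{A}\to\mathbb{C}$ linear with $\varphi(\mathbf{1}_{\mathcal{A}})=1$ (no $*$-structure, positivity or traciality is assumed). Unital subalgebras $(\mathcal{A}_i)_{i\in I}$ are freely independent (free) if $\varphi(a_1\cdots a_k)=0$ whenever $k\ge1$, $a_j\in\mathcal{A}_{i_j}$, $\varphi(a_j)=0$ for all $j$, and $i_1\ne i_2,\ i_2\neq i_3,\ldots,i_{k-1}\ne i_k$. Elements are free if the unital subalgebras they generate are free. Free cumulants $\kappa_n:\mathcal{A}^n\to\mathbb{C}$ are the multilinear functionals determined by $\varphi(a_1\cdots a_n)=\sum_{\pi\in NC(n)}\prod_{V\in\pi}\kappa_{|V|}(a_{i}:i\in V)$ (indices in each block in increasing order), where $NC(n)$ is the set of non-crossing partitions of $\{1,\ldots,n\}$; $\kappa_n(a):=\kappa_n(a,\ldots,a)$. $\mathfrak{p}\in\mathcal{A}$ is a free Poisson variable with rate $\lambda>0$ and jump size $\alpha>0$ if $\kappa_n(\mathfrak{p})=\lambda\alpha^n$ for all $n\ge1$; it is free Poisson with rate $\lambda$ if this holds for some $\alpha>0$. $\mathfrak{b}\in\mathcal{A}$ is a Bernoulli variable with parameter $p\in[0,1]$ if $\varphi(\mathfrak{b}^n)=p$ for all $n\ge1$. *)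

(* Defs.v *)
From HB Require Import structures.
From mathcomp Require Import all_boot all_order all_algebra.
From mathcomp Require Export boolp classical_sets reals.
From mathcomp Require Export complex.

Set Implicit Arguments.
Unset Strict Implicit.
Unset Printing Implicit Defensive.

Import Order.TTheory GRing.Theory Num.Theory.
Local Open Scope classical_set_scope.
Local Open Scope ring_scope.
Local Open Scope complex_scope.

Definition noncrossing (n : nat) (P : {set {set 'I_n}}) : Prop :=
  forall V W : {set 'I_n}, V \in P -> W \in P ->
  forall a b c d : 'I_n, (a < b)%N -> (b < c)%N -> (c < d)%N ->
    a \in V -> c \in V -> b \in W -> d \in W -> V = W.

Definition NC (n : nat) : {set {set {set 'I_n}}} :=
  [set P | finset.partition P [set: 'I_n] & `[< noncrossing P >]]%SET.

(* The restriction of a family to a block lists it in increasing order, since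
   [enum_val] enumerates a subset of ['I_n] increasingly. *)
Definition restr (T : Type) (n : nat) (a : 'I_n -> T) (V : {set 'I_n}) :
  'I_#|V| -> T := fun j => a (enum_val j).
Arguments restr {T n} a V j.

Section NCProbability.
Variables (R : realType) (A : algType R[i]) (phi : {scalar A}).

Definition free_subalgebras (I : Type) (B : I -> set A) : Prop :=
  forall (k : nat) (i : 'I_k -> I) (a : 'I_k -> A), (0 < k)%N ->
    (forall j, a j \in B (i j)) ->
    (forall j, phi (a j) = 0) ->
    (forall j j' : 'I_k, j' = j.+1 :> nat -> i j <> i j') ->
    phi (\prod_(j < k) a j) = 0.

Definition gen_subalgebra (S : set A) : set A :=
  smallest [set B : set A | GRing.subalg_closed (mem B)] S.

Lemma gen_subalgebra_closed (S : set A) :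
  GRing.subalg_closed (mem (gen_subalgebra S)).
Proof.
split.
- by apply/mem_set => B [[/set_mem h _ _] _].
- move=> c x y /set_mem hx /set_mem hy; apply/mem_set => B hB.
  case: (hB) => -[_ h _] _.
  by apply/set_mem/h; apply/mem_set; [exact: hx|exact: hy].
- move=> x y /set_mem hx /set_mem hy; apply/mem_set => B hB.
  case: (hB) => -[_ _ h] _.
  by apply/set_mem/h; apply/mem_set; [exact: hx|exact: hy].
Qed.

Definition free_elements (I : Type) (x : I -> A) : Prop :=
  free_subalgebras (fun i => gen_subalgebra [set x i]).

Definition freely_independent (x y : A) : Prop :=
  free_elements (fun i : bool => if i then x else y).

Definition multilinear (n : nat) (f : ('I_n -> A) -> R[i]) : Prop :=
  forall (a : 'I_n -> A) (i : 'I_n) (c : R[i]) (x y : A),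
    f [eta a with i |-> c *: x + y] =
    c * f [eta a with i |-> x] + f [eta a with i |-> y].

Definition is_free_cumulants (kappa : forall n, ('I_n -> A) -> R[i]) : Prop :=
  (forall n, (0 < n)%N -> multilinear (@kappa n)) /\
  (forall n (a : 'I_n -> A), (0 < n)%N ->
     phi (\prod_(i < n) a i) =
     \sum_(P in NC n) \prod_(V in P) kappa #|V| (restr a V)).

(* The moment-cumulant relation solved for the term of the one-block partition;
   every block of any other partition has fewer than n elements, so m = n steps
   of recursion suffice. *)
Fixpoint free_cumulant_rec (m n : nat) (a : 'I_n -> A) : R[i] :=
  if m is m'.+1 then
    phi (\prod_(i < n) a i) -
    \sum_(P in NC n | P != [set [set: 'I_n]]%SET)
       \prod_(V in P) free_cumulant_rec m' (restr a V)
  else 0.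

Definition free_cumulant (n : nat) (a : 'I_n -> A) : R[i] :=
  free_cumulant_rec n a.

Lemma NC_block_lt n (P : {set {set 'I_n}}) V :
  P \in NC n -> P != [set [set: 'I_n]]%SET -> V \in P -> (#|V| < n)%N.
Proof.
rewrite inE => /andP[hP _] nP VP.
rewrite ltn_neqAle -[leqRHS]card_ord max_card andbT.
apply: contra nP => /eqP cV.
have VT : V = [set: 'I_n]%SET.
  by apply/eqP; rewrite eqEcard finset.subsetT cardsT card_ord cV /=.
move: hP VP; rewrite VT => /and3P[_ /finset.trivIsetP tP P0] TP.
rewrite finset.eqEsubset finset.sub1set TP andbT.
apply/fintype.subsetP => W WP; rewrite finset.in_set1; apply/negPn/negP => nW.
have := tP _ _ WP TP nW.
rewrite -setI_eq0 finset.setIT => /eqP W0.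
by move: P0; rewrite -W0 WP.
Qed.

Lemma NC_full n : (0 < n)%N -> [set [set: 'I_n]]%SET \in NC n.
Proof.
move=> n0; rewrite inE; apply/andP; split; last first.
  by apply/asboolP => V W; rewrite !inE => /eqP-> /eqP->.
apply/and3P; split.
- by rewrite /finset.cover finset.big_set1.
- by apply/finset.trivIsetP => V W; rewrite !inE => /eqP-> /eqP->; rewrite eqxx.
- rewrite inE; apply/eqP => /setP/(_ (Ordinal n0)).
  by rewrite !inE.
Qed.

Lemma NC_block_gt0 n (P : {set {set 'I_n}}) V :
  P \in NC n -> V \in P -> (0 < #|V|)%N.
Proof.
rewrite inE => /andP[/and3P[_ _ P0] _] VP.
by rewrite card_gt0; apply: contraNneq P0 => <-.
Qed.

Lemma free_cumulant_rec_eq m n (a : 'I_n -> A) :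
  (0 < n <= m)%N -> free_cumulant_rec m a = free_cumulant a.
Proof.
rewrite /free_cumulant.
suff H : forall m k n (a : 'I_n -> A), (0 < n <= m)%N -> (n <= k)%N ->
    free_cumulant_rec m a = free_cumulant_rec k a by move=> ?; exact: H.
elim=> [|{}m IH] [|k] {}n {}a; rewrite ?leqn0.
- by case: n a.
- by case: n a.
- by case: n a.
move=> /andP[n0 nm] nk /=; congr (_ - _).
apply: eq_bigr => P /andP[hP nP]; apply: eq_bigr => V VP.
have h := NC_block_lt hP nP VP.
apply: IH; first by rewrite (NC_block_gt0 hP VP) -ltnS (leq_trans h).
by rewrite -ltnS (leq_trans h).
Qed.

Lemma free_cumulantE n (a : 'I_n -> A) : (0 < n)%N ->
  free_cumulant a = phi (\prod_(i < n) a i) -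
    \sum_(P in NC n | P != [set [set: 'I_n]]%SET)
       \prod_(V in P) free_cumulant (restr a V).
Proof.
case: n a => // n a _; rewrite {1}/free_cumulant /=; congr (_ - _).
apply: eq_bigr => P /andP[hP nP]; apply: eq_bigr => V VP.
apply: free_cumulant_rec_eq.
by rewrite (NC_block_gt0 hP VP) -ltnS (NC_block_lt hP nP VP).
Qed.

Lemma cumulant_full (kappa : forall n, ('I_n -> A) -> R[i]) n (a : 'I_n -> A) :
  kappa #|[set: 'I_n]%SET| (restr a [set: 'I_n]%SET) = kappa n a.
Proof.
have e : #|[set: 'I_n]%SET| = n by rewrite cardsT card_ord.
have H k (ek : k = n) (b : 'I_k -> A) :
    b = a \o cast_ord ek -> kappa k b = kappa n a.
  subst k => ->; congr kappa; apply/funext => j /=.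
  by rewrite cast_ord_id.
apply: (H _ e).
apply/funext => j /=; congr a; apply: val_inj => /=.
rewrite /enum_val enum_setT -enumT nth_enum_ord //.
by rewrite -[ltnRHS]e.
Qed.

Lemma cumulant_formulaE (kappa : forall n, ('I_n -> A) -> R[i]) n
    (a : 'I_n -> A) : (0 < n)%N ->
  \sum_(P in NC n) \prod_(V in P) kappa #|V| (restr a V) =
  kappa n a + \sum_(P in NC n | P != [set [set: 'I_n]]%SET)
                \prod_(V in P) kappa #|V| (restr a V).
Proof.
move=> n0; rewrite (bigD1 [set [set: 'I_n]]%SET) /=; last exact: NC_full.
by rewrite finset.big_set1 cumulant_full.
Qed.

Lemma free_cumulant_multilinear n : multilinear (@free_cumulant n).
Proof.
have [m] := ubnP n; elim: m n => // m IH n nm a i c x y.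
have n0 : (0 < n)%N by case: (n) i => // -[].
have phiE c' x' y' : phi (\prod_(j < n) [eta a with i |-> c' *: x' + y'] j) =
    c' * phi (\prod_(j < n) [eta a with i |-> x'] j)
    + phi (\prod_(j < n) [eta a with i |-> y'] j).
  have [l [r E]] : exists l r, forall z,
      \prod_(j < n) [eta a with i |-> z] j = l * z * r.
    have := index_enum_uniq 'I_n; have := mem_index_enum i.
    case/splitPr => s1 s2; rewrite cat_uniq /= => /and4P[_ /norP[i1 _] i2 _].
    exists (\prod_(j <- s1) a j), (\prod_(j <- s2) a j) => z.
    have N s : i \notin s ->
        \prod_(j <- s) [eta a with i |-> z] j = \prod_(j <- s) a j.
      move=> si; apply: eq_big_seq => j js /=.
      by case: eqP => // ji; rewrite -ji js in si.
    by rewrite big_cat big_cons /= eqxx !N // mulrA.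
  by rewrite !E mulrDr mulrDl -scalerAr -scalerAl linearD linearZ.
rewrite !free_cumulantE // phiE mulrBr addrACA -opprD; congr (_ + _ - _).
rewrite mulr_sumr -big_split /=; apply: eq_bigr => P /andP[hP nP].
move: (hP); rewrite inE => /andP[/and3P[/eqP cP tP _] _].
have iP : i \in finset.cover P by rewrite cP inE.
have BP := finset.pblock_mem iP; have iB : i \in finset.pblock P i by rewrite finset.mem_pblock.
rewrite !(bigD1 (finset.pblock P i) BP) /=.
set B := finset.pblock P i in BP iB *.
have rB z : restr [eta a with i |-> z] B =
    [eta restr a B with enum_rank_in iB i |-> z].
  apply/funext => j; rewrite /restr /=.
  by rewrite -{1}(enum_rankK_in iB iB) (inj_eq enum_val_inj).
have rV z : \prod_(V in P | V != B) free_cumulant (restr [eta a with i |-> z] V)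
    = \prod_(V in P | V != B) free_cumulant (restr a V).
  apply: eq_bigr => V /andP[VP VB]; congr free_cumulant.
  apply/funext => j; rewrite /restr /=; case: eqP => // ji.
  have := enum_valP j; rewrite ji => iV.
  by move: VB; rewrite /B (finset.def_pblock tP VP iV) eqxx.
rewrite !rV !rB IH; last first.
  by rewrite (leq_trans (NC_block_lt hP nP BP)).
by rewrite mulrDl mulrA.
Qed.

Lemma free_cumulantP : is_free_cumulants free_cumulant.
Proof.
split=> [n _|n a n0]; first exact: free_cumulant_multilinear.
by rewrite cumulant_formulaE // free_cumulantE // subrK.
Qed.

Lemma free_cumulant_unique (kappa : forall n, ('I_n -> A) -> R[i]) :
  is_free_cumulants kappa ->
  forall n (a : 'I_n -> A), (0 < n)%N -> kappa n a = free_cumulant a.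
Proof.
move=> [_ hk] n; have [m] := ubnP n; elim: m n => // m IH n nm a n0.
rewrite free_cumulantE // hk // cumulant_formulaE //.
rewrite -[LHS](addrK (\sum_(P in NC n | P != [set [set: 'I_n]]%SET)
                       \prod_(V in P) kappa #|V| (restr a V))).
congr (_ - _); apply: eq_bigr => P /andP[hP nP]; apply: eq_bigr => V VP.
by rewrite IH // ?(NC_block_gt0 hP VP) // (leq_trans (NC_block_lt hP nP VP)).
Qed.

Definition free_poisson (x : A) (lambda alpha : R) : Prop :=
  [/\ 0 < lambda, 0 < alpha &
      forall n : nat, (0 < n)%N ->
        free_cumulant (fun _ : 'I_n => x) = (lambda * alpha ^+ n)%:C].

Definition free_poisson_rate (x : A) (lambda : R) : Prop :=
  exists alpha : R, free_poisson x lambda alpha.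

Definition bernoulli (x : A) (p : R) : Prop :=
  0 <= p <= 1 /\ forall n : nat, (0 < n)%N -> phi (x ^+ n) = p%:C.

End NCProbability.

(* Main.v *)
Require Import Defs.
From HB Require Import structures.
From mathcomp Require Import all_boot all_order all_algebra.
From mathcomp Require Import boolp classical_sets reals.
From mathcomp Require Import complex.
From mathcomp Require Import ring.
Set Implicit Arguments.
Unset Strict Implicit.
Unset Printing Implicit Defensive.
Import Order.TTheory GRing.Theory Num.Theory.
Local Open Scope ring_scope.
Local Open Scope complex_scope.

(** Everything reduces to one recursion.  Write N_n for the sum of
    lambda ^ #blocks over the non-crossing partitions of n points.  It satisfies
    N_(n+1) = lambda N_n + \sum_(j < n) N_j N_(n-j), so an element is free
    Poisson with rate lambda and jump size alpha exactly when its moments satisfy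
      m_(n+1) = alpha (lambda m_n + \sum_(j < n) m_j m_(n-j))
    ([free_poisson_moment_rec], [moment_rec_free_poisson]).

    If p is such an element and is free from b, the recursion extends from powers
    of p to every word w in p and b, as a Schwinger-Dyson equation
      phi(p w) = alpha (lambda phi(w) + \sum_(w = u p v) phi(u) phi(p v))
    ([free_poisson_SD_ext]).  Indeed both sides are functionals of w that are
    determined by their values on alternating products of centred elements
    ([spanning]); there the equation is the recursion for the moments of p when w
    is a polynomial in p, and reads 0 = 0 by freeness otherwise.  The same
    principle shows that phi is tracial on words in p and b ([ext_trace]), and
    that b acts as an idempotent inside phi ([ext_null]), although b is a
    projection only in distribution.

    Now let lambda = 1 and put b_1 = b, b_2 = 1 - b, x_i = p b_i.  For a nonempty
    word u in x_1, x_2, traciality and orthogonality give phi(b_i u) = phi(u) if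
    the last letter of u is x_i and phi(b_i u) = 0 otherwise.  Inserting this in
    the equation for the word p (b_i w) yields
      phi(x_i w) = alpha (phi(b_i) phi(w) + \sum_(w = u x_i v) phi(x_i u) phi(v))
    ([compressed_SD]).  On powers of x_i this is the recursion of a free Poisson
    element with rate phi(b_i) and jump size alpha.  Moreover an equation of this
    shape forces freeness of x_1 and x_2: it expresses an alternating centred
    product by products of strictly smaller degree, at least one factor of which
    vanishes by induction ([SD_free]).

    For lambda <> 1 low moments suffice.  With P = phi(b), the first three moments
    of p b are m_1 = alpha lambda P, m_2 = alpha (lambda + P) m_1 and
    m_3 = alpha (lambda + P) m_2 + alpha m_1 ^ 2.  A free Poisson element with
    parameters mu, beta having these moments would satisfy beta = alpha and
    (1 - lambda) (1 - P) = 0.  Likewise phi(p b p (1 - b)) equals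
    alpha ^ 2 lambda P (1 - P), whereas freeness would require
    alpha ^ 2 lambda ^ 2 P (1 - P). *)

(** * Counting non-crossing partitions *)

Section StackSum.
Variables (K : comNzRingType) (l : K).

(** Total weight of the ways to add [n] points, one at a time, to a non-crossing
    partition with [h] outer blocks (blocks that no other block straddles).  A
    new point opens a block, at the price of a factor [l], or joins an outer
    block; joining the [j]-th one hides all later ones. *)
Fixpoint stack_sum (n h : nat) : K :=
  if n is n'.+1 then
    l * stack_sum n' h.+1 + \sum_(j < h) stack_sum n' j.+1
  else 1.

(** Either the [k] lowest outer blocks are never touched, or there is a first
    point, of index [j], that joins one of them, say the [i]-th. *)
Lemma stack_sum_floor n a k :
  stack_sum n (k + a) = stack_sum n a +
    \sum_(j < n) stack_sum j a * \sum_(i < k) stack_sum (n - j.+1) i.+1.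
Proof.
elim: n a => [|n IH] a; first by rewrite big_ord0 addr0.
rewrite [LHS]/= -addnS IH big_split_ord /=.
have -> : \sum_(i < a) stack_sum n (k + i).+1 = \sum_(i < a) stack_sum n i.+1 +
    \sum_(j < n) (\sum_(i < a) stack_sum j i.+1) *
                 \sum_(i < k) stack_sum (n - j.+1) i.+1.
  under eq_bigr => i _ do rewrite -addnS IH.
  rewrite big_split /=; congr (_ + _); rewrite exchange_big /=.
  by apply: eq_bigr => j _; rewrite mulr_suml.
rewrite big_ord_recl /= mul1r subn1 /= mulrDr mulr_sumr.
under [X in _ = _ + (_ + X)]eq_bigr => j _ do
  rewrite /bump /= add1n subSS mulrDl -mulrA.
rewrite big_split /=.
ring.
Qed.

Lemma stack_sum0S n :
  stack_sum n.+1 0 = l * stack_sum n 0 +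
    \sum_(j < n) stack_sum j 0 * stack_sum (n - j) 0.
Proof.
rewrite [LHS]/= big_ord0 addr0 -[1%N]addn0 stack_sum_floor mulrDr mulr_sumr.
congr (_ + _); apply: eq_bigr => j _.
rewrite big_ord1 mulrCA -(subnSK (ltn_ord j)) [stack_sum _.+1 0]/=.
by rewrite big_ord0 addr0.
Qed.

End StackSum.

Section NoncrossingStacks.
Import mathcomp.boot.fintype mathcomp.boot.finset.
Local Open Scope set_scope.

(** A strict total order enumerates [S]: the numbers of predecessors of its
    elements are the integers below #|S|, once each. *)
Lemma sum_rank (K : nmodType) (T : finType) (S : {set T}) (r : rel T)
    (g : nat -> K) :
  {in S, irreflexive r} -> {in S & &, transitive r} ->
  {in S &, forall u v, u != v -> r u v || r v u} ->
  \sum_(v in S) g #|[set u in S | r u v]| = \sum_(j < #|S|) g j.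
Proof.
move=> irr tr tot.
pose f v := #|[set u in S | r u v]|.
have lt u v : u \in S -> v \in S -> r u v -> (f u < f v)%N.
  move=> uS vS ruv; apply: proper_card; apply/properP; split.
    apply/subsetP => w; rewrite !inE => /andP[wS rwu].
    by rewrite wS /=; apply: tr rwu ruv.
  by exists u; rewrite !inE uS ?ruv // irr.
have injf : {in S &, injective f}.
  move=> u v uS vS e; apply/eqP/negPn/negP => /(tot _ _ uS vS).
  by case/orP => h; [have := lt u v uS vS h|have := lt v u vS uS h];
    rewrite e ltnn.
rewrite -(big_mkord xpredT g).
rewrite -big_enum -(big_map f xpredT g) /=; apply: perm_big.
have u1 : uniq [seq f v | v <- enum S].
  rewrite map_inj_in_uniq ?enum_uniq // => u v.
  by rewrite !mem_enum; apply: injf.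
have sub : {subset [seq f v | v <- enum S] <= index_iota 0 #|S|}.
  move=> _ /mapP[v vS ->]; rewrite mem_enum in vS.
  rewrite mem_index_iota leq0n /=; apply: proper_card; apply/properP; split.
    by apply/subsetP => w; rewrite inE => /andP[].
  by exists v; rewrite ?inE ?irr ?vS.
have [|e1 e2] := uniq_min_size u1 sub.
  by rewrite size_iota subn0 size_map -cardE.
by apply: uniq_perm; rewrite ?iota_uniq.
Qed.

Variable N : nat.
Implicit Types (P Q : {set {set 'I_N}}) (U V W : {set 'I_N}) (x : 'I_N).

Definition NC_initial (k : nat) : {set {set {set 'I_N}}} :=
  [set P | partition P [set i : 'I_N | (i < k)%N] & `[< noncrossing P >]].

(** Exactly the blocks to which a point to the right of all others can be added
    without creating a crossing. *)
Definition exposed Q V : Prop :=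
  forall W, W \in Q -> forall a b c : 'I_N, (a < b)%N -> (b < c)%N ->
    a \in W -> c \in W -> b \in V -> W = V.

Definition outer Q : {set {set 'I_N}} := [set V in Q | `[< exposed Q V >]].

Definition before U V : bool :=
  [forall u in U, forall v in V, (u < v)%N].

Lemma beforeP U V :
  reflect (forall u v, u \in U -> v \in V -> (u < v)%N) (before U V).
Proof.
apply: (iffP forall_inP) => [h u v uU vV|h u uU].
  by move/forall_inP: (h u uU); apply.
by apply/forall_inP => v vV; apply: h.
Qed.

(** The choice [V = set0] makes the new point a block of its own. *)
Definition attach x Q V : {set {set 'I_N}} := (x |: V) |: (Q :\ V).

Definition detach x P : {set {set 'I_N}} :=
  (pblock P x :\ x |: P :\ pblock P x) :\ set0.

Section Step.
Variables (k : nat) (x : 'I_N).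
Hypothesis xk : x = k :> nat.

Let D (m : nat) := [set i : 'I_N | (i < m)%N].

Let initialS : D k.+1 = x |: D k.
Proof.
apply/setP => i; rewrite !inE ltnS leq_eqVlt; congr (_ || _).
by rewrite -(inj_eq val_inj) /= xk.
Qed.

Section Fixed.
Variable Q : {set {set 'I_N}}.
Hypothesis QNC : Q \in NC_initial k.

Let Qpart : partition Q (D k). Proof. by move: QNC; rewrite inE => /andP[]. Qed.
Let Qnc : noncrossing Q.
Proof. by move: QNC; rewrite inE => /andP[_ /asboolP]. Qed.

Let Qlt W i : W \in Q -> i \in W -> (i < k)%N.
Proof. by move=> /(partitionS Qpart)/subsetP h /h; rewrite inE. Qed.

Let xQ W : W \in Q -> x \notin W.
Proof. by move=> WQ; apply/negP => /(Qlt WQ); rewrite xk ltnn. Qed.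

Let set0Q : set0 \notin Q. Proof. by rewrite (partition0 Qpart). Qed.

Lemma outer_set0 : set0 \notin outer Q.
Proof. by rewrite inE negb_and set0Q. Qed.

Let tQ U V i : U \in Q -> V \in Q -> i \in U -> i \in V -> U = V.
Proof.
move=> UQ VQ iU iV; have t := partition_trivIset Qpart.
by rewrite -(def_pblock t UQ iU) (def_pblock t VQ iV).
Qed.

(** Two disjoint blocks that are neither straddled by the other must occupy
    disjoint intervals. *)
Lemma before_total :
  {in outer Q &, forall U V, U != V -> before U V || before V U}.
Proof.
move=> U V; rewrite !inE => /andP[UQ /asboolP eU] /andP[VQ /asboolP eV] nUV.
apply/negPn/negP; rewrite negb_or.
case/andP => /forall_inPn/= [u uU /forall_inPn/= [v vV uv]].
case/forall_inPn => /= v' v'V /forall_inPn/= [u' u'U vu'].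
have ne i j : i \in U -> j \in V -> i != j :> nat.
  move=> iU jV; apply: contra nUV => /eqP/val_inj ij.
  by apply/eqP; apply: (tQ UQ VQ iU); rewrite ij.
have vltu : (v < u)%N by rewrite ltn_neqAle eq_sym ne // leqNgt.
have u'ltv' : (u' < v')%N by rewrite ltn_neqAle ne // leqNgt.
case: (ltngtP u' v) => [h|h|/eqP h]; last by move: (ne _ _ u'U vV); rewrite h.
  by move/eqP: nUV; apply; apply: (eV U UQ u' v u).
by move/eqP: nUV; apply; apply/esym/(eU V VQ v u' v').
Qed.

Lemma before_irr : {in outer Q, irreflexive before}.
Proof.
move=> U; rewrite inE => /andP[UQ _]; apply/negP => /beforeP h.
have /set0Pn[u uU] := partition_neq0 Qpart UQ.
by have := h u u uU uU; rewrite ltnn.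
Qed.

Lemma before_trans : {in outer Q & &, transitive before}.
Proof.
move=> V U W; rewrite inE => /andP[VQ _] _ _ /beforeP UV /beforeP VW.
have /set0Pn[v vV] := partition_neq0 Qpart VQ.
by apply/beforeP => u w uU wW; apply: ltn_trans (UV u v uU vV) (VW v w vV wW).
Qed.

Section Attach.
Variable V : {set 'I_N}.
Hypothesis Vok : V \in set0 |: outer Q.

Let VQ i : i \in V -> V \in Q /\ exposed Q V.
Proof.
move: Vok; rewrite !inE => /predU1P[->|]; first by rewrite inE.
by case/andP => ? /asboolP.
Qed.

Let Vlt i : i \in V -> (i < k)%N.
Proof. by move=> iV; apply: (Qlt _ iV); case: (VQ iV). Qed.

Let xV : x \notin V. Proof. by apply/negP => /Vlt; rewrite xk ltnn. Qed.

Let xVQ : x |: V \notin Q.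
Proof. by apply/negP => /xQ; rewrite !inE eqxx. Qed.

Let attachP U : reflect (U = x |: V \/ U \in Q /\ U <> V) (U \in attach x Q V).
Proof.
rewrite !inE; apply: (iffP orP) => [] [].
- by move/eqP; left.
- by case/andP => /eqP ? ?; right.
- by move=> ->; left.
- by case=> ? /eqP ?; right; apply/andP.
Qed.

Let ltxV (i : 'I_N) (j : nat) : (i < j)%N -> i \in x |: V -> (j <= k)%N -> i \in V.
Proof.
by move=> ij; rewrite !inE => /predU1P[ix|//]; rewrite -xk -ix leqNgt ij.
Qed.

Lemma attach_NC : attach x Q V \in NC_initial k.+1.
Proof.
rewrite inE; apply/andP; split.
  rewrite -/(D k.+1) initialS.
  have -> : x |: D k = (x |: V) :|: (D k :\: V).
    apply/setP => i; rewrite !inE; case: eqP => //= _.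
    by case iV: (i \in V); rewrite //= (Vlt iV).
  apply: partitionU1.
  - move: Vok; rewrite !inE => /predU1P[->|/andP[VQ' _]].
      have -> : Q :\ set0 = Q.
        by apply/setP => W; rewrite !inE; case: eqP => // ->; rewrite (negbTE set0Q).
      by rewrite setD0.
    exact: partitionD1.
  - by apply/set0Pn; exists x; rewrite !inE eqxx.
  - rewrite -setI_eq0; apply/eqP/setP => i; rewrite !inE.
    case: eqP => [->|_]; first by rewrite xk ltnn andbF.
    by case: (i \in V).
apply/asboolP => V1 W1 /attachP[->|[V1Q V1V]] /attachP[->|[W1Q W1V]] //
  a b c d ab bc cd aV cV bW dW.
- have dk := Qlt W1Q dW.
  have a' := ltxV (ltn_trans ab (ltn_trans bc cd)) aV (ltnW dk).
  have c' := ltxV cd cV (ltnW dk).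
  have [VQ' _] := VQ a'.
  by case: W1V; apply/esym/(Qnc VQ' W1Q ab bc cd).
- have b' := ltxV bc bW (ltnW (Qlt V1Q cV)).
  have [VQ' eV] := VQ b'; case: V1V.
  exact: (eV V1 V1Q a b c).
- exact: (Qnc V1Q W1Q ab bc cd).
Qed.

(** The enlarged block reaches the last point, hence straddles all the outer blocks
    that do not lie to the left of it. *)
Lemma outer_attach :
  outer (attach x Q V) = (x |: V) |: [set W in outer Q | before W V].
Proof.
apply/setP => U; rewrite inE; apply/andP/idP => [[/attachP]|].
  case=> [-> _|[UQ UV] /asboolP eU]; rewrite !inE ?eqxx // UQ /=.
  have nUV : x |: V <> U by move=> e; move: xVQ; rewrite e UQ.
  apply/orP; right; apply/andP; split.
    apply/asboolP => W WQ a b c ab bc aW cW bU.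
    have [WV|/eqP WV] := eqVneq W V.
      by case: nUV; apply: (eU _ _ a b c) => //;
        [apply/attachP; left|rewrite !inE -WV aW orbT|rewrite !inE -WV cW orbT].
    by apply: (eU W _ a b c) => //; apply/attachP; right.
  apply/beforeP => u v uU vV; rewrite ltnNge; apply/negP => vu.
  have [VQ' _] := VQ vV.
  have vu' : (v < u)%N.
    rewrite ltn_neqAle vu andbT; apply/negP => /eqP/val_inj e.
    by apply: UV; apply: (tQ UQ VQ' uU); rewrite -e.
  case: nUV; apply: (eU _ _ v u x) => //; first by apply/attachP; left.
  - by rewrite xk (Qlt UQ uU).
  - by rewrite !inE vV orbT.
  - by rewrite !inE eqxx.
rewrite !inE => /predU1P[->|/andP[/andP[UQ /asboolP eU] /beforeP UV]].
  rewrite eqxx; split=> //.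
  apply/asboolP => W /attachP[->|[WQ WV]] // a b c ab bc aW cW bV.
  have b' := ltxV bc bV (ltnW (Qlt WQ cW)).
  have [VQ' eV] := VQ b'.
  by case: WV; apply: (eV W WQ a b c).
have nU : U != V.
  apply/eqP => e; have /set0Pn[u uU] := partition_neq0 Qpart UQ.
  by have := UV u u uU; rewrite -e ltnn => /(_ uU).
rewrite UQ nU orbT; split=> //.
apply/asboolP => W /attachP[->|[WQ WV]] a b c ab bc aW cW bU; last exact: (eU W WQ a b c).
have aV := ltxV ab aW (ltnW (Qlt UQ bU)).
by have := UV b a bU aV; rewrite ltnNge (ltnW ab).
Qed.

Lemma card_outer_attach :
  #|outer (attach x Q V)| = #|[set W in outer Q | before W V]|.+1.
Proof.
by rewrite outer_attach cardsU1 !inE (negbTE xVQ).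
Qed.

Lemma card_attach : #|attach x Q V| = ((V == set0) + #|Q|)%N.
Proof.
rewrite /attach cardsU1 !inE (negbTE xVQ) andbF /=.
rewrite [in RHS](cardsD1 V Q) addnA; congr (_ + _)%N.
move: Vok; rewrite !inE => /predU1P[->|/andP[VQ' _]].
  by rewrite eqxx (negbTE set0Q).
by rewrite VQ' (negbTE (partition_neq0 Qpart VQ')).
Qed.

Lemma pblock_attach : pblock (attach x Q V) x = x |: V.
Proof.
apply: def_pblock; last by rewrite !inE eqxx.
  by move: attach_NC; rewrite inE => /andP[/partition_trivIset].
by apply/attachP; left.
Qed.

Lemma attachK : detach x (attach x Q V) = Q /\
  pblock (attach x Q V) x :\ x = V.
Proof.
rewrite /detach pblock_attach.
have -> : (x |: V) :\ x = V by rewrite setU1K.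
split=> //.
apply/setP => W; rewrite !inE.
have [->|W0] := eqVneq W set0; first by rewrite (negbTE set0Q).
have [eWV|WV] := eqVneq W V; first last.
  rewrite /=; case: (eqVneq W (x |: V)) => [->|//].
  by rewrite (negbTE xVQ).
by move: Vok; rewrite -eWV !inE (negbTE W0) => /andP[->].
Qed.

End Attach.
End Fixed.

Lemma detach_NC P : P \in NC_initial k.+1 ->
  [/\ detach x P \in NC_initial k,
      pblock P x :\ x \in set0 |: outer (detach x P) &
      attach x (detach x P) (pblock P x :\ x) = P].
Proof.
rewrite inE => /andP[]; rewrite -/(D k.+1) => Pp /asboolP Pnc.
have t := partition_trivIset Pp.
have xc : x \in cover P by rewrite (cover_partition Pp) inE xk ltnSn.
have BP := pblock_mem xc.
have xB : x \in pblock P x by rewrite mem_pblock.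
set B := pblock P x in BP xB *; rewrite /detach -/B.
have BD : B \subset D k.+1 := partitionS Pp BP.
have P0 := partition0 Pp.
have disj W i : W \in P -> i \in W -> i \in B -> W = B.
  by move=> WP iW iB; rewrite -(def_pblock t WP iW) (def_pblock t BP iB).
have BxP : B :\ x \notin P.
  apply/negP => h; have /set0Pn[i iB] := partition_neq0 Pp h.
  have := disj _ i h iB; move: iB; rewrite !inE => /andP[ix iB] /(_ iB).
  by move/setP/(_ x); rewrite !inE eqxx xB.
pose Q := (B :\ x |: P :\ B) :\ set0; rewrite -/Q.
have QE : Q = (if B :\ x == set0 then P :\ B else B :\ x |: P :\ B).
  apply/setP => W; rewrite /Q !inE; case: ifP => [/eqP ->|B0]; rewrite !inE.
    by have [->|] := eqVneq W set0; rewrite ?P0 ?andbF.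
  have [->|//] := eqVneq W set0; rewrite P0 andbF orbF /=.
  by rewrite eq_sym B0.
have Qp : partition Q (D k).
  have DkE : (B :\ x) :|: (D k.+1 :\: B) = D k.
    rewrite initialS; apply/setP => i; rewrite !inE.
    have [->|ix /=] := eqVneq i x; first by rewrite xB /= xk ltnn.
    case iB: (i \in B) => //=.
    by move/subsetP/(_ i iB): BD; rewrite initialS !inE (negbTE ix).
  rewrite QE -DkE; case: ifP => [/eqP->|/negbT B0].
    by rewrite set0U; apply: partitionD1.
  apply: partitionU1 => //; first exact: partitionD1.
  rewrite -setI_eq0; apply/eqP/setP => i; rewrite !inE.
  by case: (i \in B); rewrite !andbF.
have QP W : W \in Q -> W = B :\ x \/ W \in P /\ W <> B.
  by rewrite !inE => /andP[_ /orP[/eqP|/andP[/eqP]]]; [left|right].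
have PQ W : W \in P -> W <> B -> W \in Q.
  move=> WP /eqP WB; rewrite !inE WP WB orbT andbT.
  exact: (partition_neq0 Pp WP).
split.
- rewrite inE Qp; apply/asboolP => V W /QP[->|[VP VB]] /QP[->|[WP WB]] //
    a b c d ab bc cd aV cV bW dW.
  + move: aV cV; rewrite !inE => /andP[_ aB] /andP[_ cB].
    by case: WB; rewrite -(Pnc _ _ BP WP a b c d).
  + move: bW dW; rewrite !inE => /andP[_ bB] /andP[_ dB].
    by case: VB; rewrite (Pnc _ _ VP BP a b c d).
  + exact: (Pnc _ _ VP WP a b c d).
- rewrite !inE; have [//|/= B0] := eqVneq (B :\ x) set0.
  rewrite eqxx /=; apply/asboolP => W /QP[->//|[WP WB]] a b c ab bc aW cW.
  rewrite !inE => /andP[bx bB]; case: WB.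
  have [cx|cx] := eqVneq c x; first by apply: (disj _ x WP) => //; rewrite -cx.
  apply: (Pnc _ _ WP BP a b c x) => //.
  have : W \subset D k.+1 := partitionS Pp WP.
  move/subsetP/(_ c cW); rewrite inE ltnS leq_eqVlt -xk.
  by rewrite (inj_eq val_inj) (negbTE cx).
- rewrite /attach setD1K //; apply/setP => W; rewrite !inE.
  have [->|WB /=] := eqVneq W B; first by rewrite BP.
  have [->|W1] := eqVneq W (B :\ x); first by rewrite (negbTE BxP).
  by rewrite /= andb_idl // => /(partition_neq0 Pp).
Qed.

(** Removing the last point is a bijection onto the pairs of a smaller non-crossing
    partition and an outer block of it, or none. *)
Lemma sum_NC_step (K : nmodType) (f : {set {set 'I_N}} -> K) :
  \sum_(P in NC_initial k.+1) f P =
  \sum_(Q in NC_initial k) \sum_(V in set0 |: outer Q) f (attach x Q V).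
Proof.
rewrite pair_big_dep /=.
rewrite (reindex_onto (fun QV : _ * _ => attach x QV.1 QV.2)
  (fun P => (detach x P, pblock P x :\ x))) /=; last first.
  by move=> P /detach_NC[].
apply: eq_bigl => -[Q V] /=; apply/andP/andP => -[].
  by move=> h /eqP[e1 e2]; have := detach_NC h; rewrite e1 e2 => -[].
move=> QNC Vok; split; first exact: attach_NC.
by have [-> ->] := attachK QNC Vok.
Qed.

End Step.
End NoncrossingStacks.

Section Count.
Import mathcomp.boot.fintype mathcomp.boot.finset.
Local Open Scope set_scope.
Variables (K : comNzRingType) (l : K) (N : nat).

(** The left-hand side does not depend on [k]: this is the invariant of adding the
    points one at a time. *)
Lemma sum_NC_initial k m : (k + m = N)%N ->
  \sum_(Q in NC_initial N k) l ^+ #|Q| * stack_sum l m #|outer Q| =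
  stack_sum l N 0.
Proof.
elim: k m => [|k IH] m.
  rewrite add0n => ->; rewrite (big_pred1 set0).
    by rewrite /outer cards0 expr0 mul1r; congr stack_sum; apply: eq_card0 => V;
       rewrite !inE.
  move=> Q; rewrite inE; have -> : [set i : 'I_N | (i < 0)%N] = set0.
    by apply/setP => i; rewrite !inE.
  rewrite partition_set0 andb_idr // => /eqP->.
  by apply/asboolP => V W; rewrite inE.
move=> kmN; have kN : (k < N)%N by rewrite -kmN leq_addr.
rewrite (sum_NC_step (x := Ordinal kN)) // -(IH m.+1); last by rewrite -addSnnS.
apply: eq_bigr => Q QNC; rewrite big_setU1 /=; last exact: outer_set0 QNC.
have Vok0 : set0 \in set0 |: outer Q by rewrite !inE eqxx.
have xk : Ordinal kN = k :> nat by [].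
rewrite (card_attach xk QNC Vok0) (card_outer_attach xk QNC Vok0) eqxx.
have -> : [set W in outer Q | before W set0] = outer Q.
  apply/setP => W; rewrite !inE andb_idr // => _.
  by apply/beforeP => u v _; rewrite inE.
rewrite mulrDr exprD expr1 mulrCA -mulrA; congr (_ + _).
rewrite mulr_sumr.
rewrite -(sum_rank (S := outer Q) (r := @before N)
            (fun j => l ^+ #|Q| * stack_sum l m j.+1)); first last.
- exact: before_total QNC.
- exact: before_trans QNC.
- exact: before_irr QNC.
apply: eq_bigr => V VQ; have Vok : V \in set0 |: outer Q by rewrite inE VQ orbT.
rewrite (card_attach xk QNC Vok) (card_outer_attach xk QNC Vok).
case: eqP VQ => [->|//]; by rewrite (negbTE (outer_set0 QNC)).
Qed.

Lemma sum_NC : \sum_(P in NC N) l ^+ #|P| = stack_sum l N 0.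
Proof.
rewrite -(sum_NC_initial (addn0 N)); apply: eq_big => [P|P _]; last by rewrite mulr1.
rewrite !inE; congr (partition _ _ && _).
by apply/setP => i; rewrite !inE ltn_ord.
Qed.

Lemma sum_NC_weight (a : K) :
  \sum_(P in NC N) \prod_(V in P) (l * a ^+ #|V|) = a ^+ N * stack_sum l N 0.
Proof.
rewrite -sum_NC mulr_sumr; apply: eq_bigr => P; rewrite inE => /andP[Pp _].
rewrite big_split /= prodr_const mulrC; congr (_ * _).
by rewrite prodrXr -(card_partition Pp) cardsT card_ord.
Qed.

End Count.

(** * Moments of free Poisson elements *)

Section FreePoisson.
Variables (R : realType) (A : algType R[i]) (phi : {scalar A}).
Hypothesis phi1 : phi 1 = 1.

Lemma free_poisson_moment (x : A) (lambda alpha : R) n :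
  free_poisson phi x lambda alpha ->
  phi (x ^+ n) = alpha%:C ^+ n * stack_sum lambda%:C n 0.
Proof.
case=> _ _ kx; case: n => [|n]; first by rewrite !expr0 mul1r phi1.
have := (free_cumulantP phi).2 n.+1 (fun=> x) isT.
rewrite prodr_const card_ord => ->; rewrite -sum_NC_weight.
apply: eq_bigr => P PNC; apply: eq_bigr => V VP.
rewrite [LHS](kx _ (NC_block_gt0 PNC VP)).
by rewrite rmorphM rmorphXn.
Qed.

Lemma moment_free_poisson (x : A) (lambda alpha : R) :
  0 < lambda -> 0 < alpha ->
  (forall n, phi (x ^+ n) = alpha%:C ^+ n * stack_sum lambda%:C n 0) ->
  free_poisson phi x lambda alpha.
Proof.
move=> l0 a0 mx; split=> // n; have [m] := ubnP n.
elim: m n => // m IH n nm n0; rewrite free_cumulantE //.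
rewrite prodr_const card_ord mx -sum_NC_weight.
have := @cumulant_formulaE R A
  (fun n _ => (lambda * alpha ^+ n)%:C) n (fun=> x) n0.
under eq_bigr => P _ do under eq_bigr => V _ do rewrite rmorphM rmorphXn.
move=> ->; apply/eqP; rewrite subr_eq; apply/eqP; congr (_ + _).
apply: eq_bigr => P /andP[PNC P1]; apply: eq_bigr => V VP.
apply/esym/(IH _ _ (NC_block_gt0 PNC VP)).
by rewrite (leq_trans (NC_block_lt PNC P1 VP)).
Qed.

Lemma free_poisson_moment_rec (x : A) (lambda alpha : R) n :
  free_poisson phi x lambda alpha ->
  phi (x ^+ n.+1) = alpha%:C * (lambda%:C * phi (x ^+ n) +
    \sum_(j < n) phi (x ^+ j) * phi (x ^+ (n - j))).
Proof.
move=> px; rewrite !(free_poisson_moment _ px) stack_sum0S exprS -mulrA.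
congr (_ * _); rewrite mulrDr mulrCA; congr (_ + _).
rewrite mulr_sumr; apply: eq_bigr => j _.
rewrite !(free_poisson_moment _ px) mulrACA -exprD subnKC //.
exact: ltnW.
Qed.

Lemma moment_rec_free_poisson (x : A) (lambda alpha : R) :
  0 < lambda -> 0 < alpha ->
  (forall n, phi (x ^+ n.+1) = alpha%:C * (lambda%:C * phi (x ^+ n) +
    \sum_(j < n) phi (x ^+ j) * phi (x ^+ (n - j)))) ->
  free_poisson phi x lambda alpha.
Proof.
move=> l0 a0 rec; apply: moment_free_poisson => // n.
have [m] := ubnP n; elim: m n => // m IH [|n] nm.
  by rewrite !expr0 mul1r phi1.
rewrite rec stack_sum0S exprS -mulrA; congr (_ * _).
rewrite IH // mulrDr mulrCA; congr (_ + _).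
rewrite mulr_sumr; apply: eq_bigr => j _.
rewrite !IH; [|by rewrite (leq_ltn_trans (leq_subr _ _))
  |by rewrite (ltn_trans (ltn_ord j))].
rewrite mulrACA -exprD subnKC //.
exact: ltnW.
Qed.

End FreePoisson.

(** * Moment functionals on words *)

Section Words.
Variables (K : comNzRingType) (I : eqType).
Local Notation letter := (I * {poly K})%type.
Implicit Types (F G H : seq I -> K) (c d : I) (q r : {poly K}) (s t : seq letter).

Definition shift c F : seq I -> K := fun w => F (c :: w).

(** A functional on words in the letters of [I] is a functional on non-commutative
    polynomials; this is the functional [f |-> F (q(c) f)]. *)
Definition act c q F : seq I -> K :=
  fun w => \sum_(i < size q) q`_i * F (nseq i c ++ w).

(** The value of [F] on the product of the polynomials [l.2] in the variables
    [l.1]. *)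
Fixpoint ext F s : K := if s is l :: s' then ext (act l.1 l.2 F) s' else F [::].

Lemma actE n c q F w : (size q <= n)%N ->
  act c q F w = \sum_(i < n) q`_i * F (nseq i c ++ w).
Proof.
move=> qn; rewrite /act (big_ord_widen n (fun i => q`_i * F (nseq i c ++ w)) qn).
rewrite big_mkcond; apply: eq_bigr => i _; case: ltnP => // h.
by rewrite nth_default // mul0r.
Qed.

Lemma actD c q r F w : act c (q + r) F w = act c q F w + act c r F w.
Proof.
pose n := maxn (size q) (size r).
rewrite !(@actE n) ?leq_maxl ?leq_maxr ?size_polyD // -big_split /=.
by apply: eq_bigr => i _; rewrite coefD mulrDl.
Qed.

Lemma actC c (k : K) F w : act c k%:P F w = k * F w.
Proof. by rewrite (@actE 1) ?size_polyC_leq1 // big_ord1 coefC. Qed.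

Lemma act0 c F w : act c 0 F w = 0.
Proof. by rewrite actC mul0r. Qed.

Lemma actMX c q F : act c (q * 'X) F = act c q (shift c F).
Proof.
apply/funext => w; rewrite (@actE (size q).+1); last first.
  by rewrite (leq_trans (size_polyMleq _ _)) // size_polyX addn2.
rewrite big_ord_recl coefMX mul0r add0r; apply: eq_bigr => i _.
by rewrite coefMX.
Qed.

Lemma act_lin c q (k : K) F G w :
  act c q (fun v => k * F v + G v) w = k * act c q F w + act c q G w.
Proof.
rewrite /act mulr_sumr -big_split; apply: eq_bigr => i _ /=.
by rewrite mulrDr mulrCA.
Qed.

Lemma actZ c (k : K) q F w : act c (k *: q) F w = k * act c q F w.
Proof.
rewrite (@actE (size q)) ?size_scale_leq // /act mulr_sumr.
by apply: eq_bigr => i _; rewrite coefZ mulrA.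
Qed.

Lemma actM c q r F : act c (q * r) F = act c r (act c q F).
Proof.
elim/poly_ind: q F => [|q k IH] F; apply/funext => w.
  rewrite mul0r act0 /act big1 // => i _.
  by rewrite size_poly0 big_ord0 mulr0.
rewrite mulrDl mulrAC actD actMX IH mul_polyC actZ addrC -act_lin.
by congr act; apply/funext => v; rewrite actD actMX actC addrC.
Qed.

Lemma ext_lin (k : K) F G s :
  ext (fun w => k * F w + G w) s = k * ext F s + ext G s.
Proof.
elim: s F G => [//|[c q] s IH] F G /=; rewrite -IH; congr ext.
by apply/funext => w; rewrite act_lin.
Qed.

Lemma ext0 s : ext (fun=> 0) s = 0.
Proof.
elim: s => //= -[c q] s {2}<-; congr ext; apply/funext => w.
by rewrite /act big1 // => i _; rewrite mulr0.
Qed.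

Lemma extZ (k : K) F s : ext (fun w => k * F w) s = k * ext F s.
Proof.
by have := ext_lin k F (fun=> 0) s; rewrite ext0 addr0 => <-;
  congr ext; apply/funext => w; rewrite addr0.
Qed.

Lemma extD F G s : ext (fun w => F w + G w) s = ext F s + ext G s.
Proof.
by have := ext_lin 1 F G s; rewrite mul1r => <-;
  congr ext; apply/funext => w; rewrite mul1r.
Qed.

Lemma ext_sum n (k : 'I_n -> K) (F : 'I_n -> seq I -> K) s :
  ext (fun w => \sum_i k i * F i w) s = \sum_i k i * ext (F i) s.
Proof.
elim: n k F => [|n IH] k F.
  rewrite [RHS]big_ord0 -[RHS](ext0 s).
  by congr ext; apply/funext => w; rewrite big_ord0.
rewrite big_ord_recl -IH -ext_lin; congr ext.
by apply/funext => w; rewrite big_ord_recl.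
Qed.




(** The only properties of [ext F] that centring arguments use.  Unlike being of the
    form [ext F], they are visibly stable under adding letters on either side. *)
Definition letterwise (Theta : seq letter -> K) : Prop :=
  (forall s t c q (k : K), Theta (s ++ (c, q + k%:P) :: t) =
     Theta (s ++ (c, q) :: t) + k * Theta (s ++ t)) /\
  (forall s t c q r,
     Theta (s ++ (c, q) :: (c, r) :: t) = Theta (s ++ (c, q * r) :: t)).

Lemma ext_letterwise F : letterwise (ext F).
Proof.
split=> s t c q => [k|r]; elim: s F => [|[d q'] s IH] F //=; first last.
  by rewrite actM.
rewrite [RHS]addrC -ext_lin; congr ext; apply/funext => w.
by rewrite actD actC addrC.
Qed.

Lemma letterwise_ctx Theta s0 t0 : letterwise Theta ->
  letterwise (fun s => Theta (s0 ++ s ++ t0)).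
Proof.
by case=> h1 h2; split=> s t c q r; rewrite -?catA ?cat_cons ?(catA s0) ?h1 ?h2.
Qed.

Lemma letterwiseB Theta1 Theta2 : letterwise Theta1 -> letterwise Theta2 ->
  letterwise (fun s => Theta1 s - Theta2 s).
Proof.
move=> [h1 h2] [h3 h4]; split=> s t c q r; last by rewrite h2 h4.
by rewrite h1 h3 mulrBr opprD addrACA.
Qed.

Definition alternating s : bool := sorted (fun c d => c != d) (map fst s).

Lemma not_alternating s : ~~ alternating s ->
  exists s1 s2 c q r, s = s1 ++ (c, q) :: (c, r) :: s2.
Proof.
elim: s => [//|[c q] [//|[d r] s] IH]; rewrite /alternating /= negb_and negbK.
case/orP => [/eqP<-|/IH [s1 [s2 [e [q' [r' ->]]]]]].
  by exists [::], s, c, q, r.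
by exists ((c, q) :: s1), s2, e, q', r'.
Qed.

Lemma alternating_cat s t : alternating (s ++ t) -> alternating s /\ alternating t.
Proof. by rewrite /alternating map_cat => /cat_sorted2[]. Qed.

Lemma alternating_cons c q s :
  alternating ((c, q) :: s) -> alternating s.
Proof. by rewrite -cat1s => /alternating_cat[]. Qed.

Lemma alternating_rcons c q s :
  alternating (rcons s (c, q)) -> alternating s.
Proof. by rewrite -cats1 => /alternating_cat[]. Qed.

Section Functional.
Variable F : seq I -> K.
Hypothesis F1 : F [::] = 1.

Definition mean c q : K := ext F [:: (c, q)].

Definition centred s : bool := all (fun l => mean l.1 l.2 == 0) s.

Definition center c q : {poly K} := q - (mean c q)%:P.

Lemma meanD c q r : mean c (q + r) = mean c q + mean c r.
Proof. exact: actD. Qed.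

Lemma meanC c (k : K) : mean c k%:P = k.
Proof. by rewrite /mean /= actC F1 mulr1. Qed.

Lemma mean0 c : mean c 0 = 0. Proof. exact: act0. Qed.

Lemma mean_center c q : mean c (center c q) = 0.
Proof. by rewrite meanD -polyCN meanC subrr. Qed.

Lemma size_center c q : (size (center c q) <= size q)%N.
Proof.
rewrite /center; have [->|q0] := eqVneq q 0.
  by rewrite mean0 subrr.
rewrite (leq_trans (size_polyD _ _)) // geq_max leqnn size_polyN.
by rewrite (leq_trans (size_polyC_leq1 _)) // size_poly_gt0.
Qed.

Lemma centerE Theta s t c q : letterwise Theta ->
  Theta (s ++ (c, q) :: t) =
  Theta (s ++ (c, center c q) :: t) + mean c q * Theta (s ++ t).
Proof. by case=> h _; rewrite -h subrK. Qed.

(** Alternating products of centred polynomials, together with 1, span the free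
    algebra: adjacent letters of the same colour merge, and replacing a letter by
    its centred version costs a shorter word. *)
Lemma spanning Theta : letterwise Theta -> Theta [::] = 0 ->
  (forall s, s != [::] -> alternating s -> centred s -> Theta s = 0) ->
  forall s, Theta s = 0.
Proof.
move=> lw T0 Tz s; have [n] := ubnP (size s); elim: n s => // n IH s sn.
have [alt|/not_alternating[s1 [s2 [c [q [r E]]]]]] := boolP (alternating s).
  suff H s1 s2 : (size (s1 ++ s2) <= n)%N -> alternating (s1 ++ s2) ->
      centred s1 -> Theta (s1 ++ s2) = 0 by exact: (H [::] s).
  elim: s2 s1 => [|[c q] s2 IH2] s1 sz a cs1.
    rewrite cats0 in a sz *; have [->//|s10] := eqVneq s1 [::].
    exact: Tz.
  rewrite centerE // (IH (s1 ++ s2)) ?mulr0 ?addr0; last first.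
    by rewrite (leq_trans _ sz) // !size_cat /= addnS.
  rewrite -cat_rcons; apply: IH2.
  - by move: sz; rewrite cat_rcons !size_cat.
  - by move: a; rewrite cat_rcons /alternating !map_cat.
  - by rewrite /centred all_rcons /= mean_center eqxx.
by rewrite E lw.2 IH //; move: sn; rewrite E !size_cat /= !addnS ltnS.
Qed.

Definition total s : nat := sumn [seq size (polyseq l.2) | l <- s].

Lemma total_cat s t : total (s ++ t) = (total s + total t)%N.
Proof. by rewrite /total map_cat sumn_cat. Qed.

Lemma total_cons c q s : total ((c, q) :: s) = (size q + total s)%N.
Proof. by []. Qed.

Lemma total_rcons c q s : total (rcons s (c, q)) = (total s + size q)%N.
Proof. by rewrite -cats1 total_cat /total /= addn0. Qed.

(** Freeness, restricted to products of total size at most [n] so that it can be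
    the hypothesis of an induction. *)
Definition vanishing n : Prop := forall s, s != [::] -> alternating s ->
  centred s -> (total s <= n)%N -> ext F s = 0.

Definition free_moments : Prop := forall n, vanishing n.

Section Ends.
Variable n : nat.
Hypothesis Fn : vanishing n.

(** The letter next to an alternating centred product need not be centred: its mean
    multiplies a shorter product, which vanishes too.  The next two lemmas do the
    same at the right end and at both ends. *)
Lemma ext_head c q s : s != [::] -> alternating ((c, q) :: s) -> centred s ->
  (total ((c, q) :: s) <= n)%N -> ext F ((c, q) :: s) = 0.
Proof.
move=> s0 a cs ts; have lw := ext_letterwise F.
rewrite -[LHS]/(ext F ([::] ++ _)) (centerE _ _ _ _ lw) /=.
have -> : ext F s = 0.
  apply: Fn => //; first exact: alternating_cons a.
  by rewrite (leq_trans _ ts) // total_cons leq_addl.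
rewrite mulr0 addr0 -[LHS]/(ext F ((c, center c q) :: s)); apply: Fn => //.
  by rewrite /centred /= mean_center eqxx.
by rewrite (leq_trans _ ts) // !total_cons leq_add2r size_center.
Qed.

Lemma ext_last c q s : s != [::] -> alternating (rcons s (c, q)) -> centred s ->
  (total (rcons s (c, q)) <= n)%N -> ext F (rcons s (c, q)) = 0.
Proof.
move=> s0 a cs ts; have lw := ext_letterwise F.
rewrite -cats1 (centerE _ _ _ _ lw) cats0 cats1.
rewrite (Fn s0) ?mulr0 ?addr0 //; last first.
- by rewrite (leq_trans _ ts) // total_rcons leq_addr.
- exact: alternating_rcons a.
apply: Fn => //.
- by case: (s).
- by move: a; rewrite /alternating !map_rcons.
- by rewrite /centred all_rcons /= mean_center eqxx.
by rewrite (leq_trans _ ts) // !total_rcons leq_add2l size_center.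
Qed.

Lemma ext_both c q d r s : s != [::] ->
  alternating ((c, q) :: rcons s (d, r)) -> centred s ->
  (total ((c, q) :: rcons s (d, r)) <= n)%N ->
  ext F ((c, q) :: rcons s (d, r)) = 0.
Proof.
move=> s0 a cs ts; have lw := ext_letterwise F.
rewrite -[LHS]/(ext F ([::] ++ _)) (centerE _ _ _ _ lw) /=.
rewrite ext_last ?mulr0 ?addr0 //; last first.
- by rewrite (leq_trans _ ts) // total_cons leq_addl.
- exact: alternating_cons a.
rewrite -[LHS]/(ext F (rcons ((c, center c q) :: s) (d, r))).
apply: ext_last => //.
- by rewrite /centred /= mean_center eqxx.
by rewrite (leq_trans _ ts) // !total_cons leq_add2r size_center.
Qed.

End Ends.

Section FreeMoments.
Hypothesis Ffree : free_moments.

(** The letter [l] may have the colour of the head of [s]; then the two merge, and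
    [1 < size s] leaves a centred letter behind them. *)
Lemma ext_cons_long l s : (1 < size s)%N -> alternating s -> centred s ->
  ext F (l :: s) = 0.
Proof.
case: l s => c q [//|[d r] [//|l' s]] _ a cs.
have [e|cd] := eqVneq c d; last first.
  apply: (ext_head (@Ffree _)) => //; by rewrite /alternating /= cd.
rewrite -e in a cs *.
rewrite -[LHS]/(ext F ([::] ++ _)) (ext_letterwise F).2 -[LHS]/(ext F (_ :: _)).
apply: (ext_head (q := q * r) (@Ffree _)) => //.
by case/andP: cs.
Qed.

Lemma ext_rcons_long l s : (1 < size s)%N -> alternating s -> centred s ->
  ext F (rcons s l) = 0.
Proof.
case: l => c q; elim/last_ind: s => // s [d r] _ ss a cs.
have s0 : s != [::] by case: (s) ss.
have cs' : centred s by move: cs; rewrite /centred all_rcons => /andP[].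
have [e|cd] := eqVneq c d; last first.
  apply: (ext_last (@Ffree _)) => //; first by case: (s).
  rewrite /alternating !map_rcons /= in a *.
  case: (s) s0 a => //= m s' _; rewrite !rcons_path last_rcons /= => ->.
  by rewrite eq_sym.
rewrite -cats1 cat_rcons e.
rewrite ((ext_letterwise F).2 s [::] d r q) cats1.
apply: (ext_last (@Ffree _)) => //.
by rewrite /alternating !map_rcons in a *.
Qed.

(** Only products [s] of length one contribute on alternating centred words, and
    polynomials in the same variable commute. *)
Lemma ext_trace l s : ext F (l :: s) = ext F (rcons s l).
Proof.
have lw := letterwiseB (letterwise_ctx [:: l] [::] (ext_letterwise F))
             (letterwise_ctx [::] [:: l] (ext_letterwise F)).
have H t : ext F ([:: l] ++ t ++ [::]) - ext F ([::] ++ t ++ [:: l]) = 0; last first.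
  apply/eqP; rewrite -subr_eq0; apply/eqP; have := H s.
  by rewrite cats0 cats1.
apply: (spanning lw) => {s t} [|s s0 a cs]; first by rewrite subrr.
rewrite cats0 cats1 {lw} -[[:: l] ++ s]/(l :: s) -[[::] ++ _]/(rcons _ _).
case: s s0 a cs => [//|m [|m' s]] _ a cs; last first.
  by rewrite ext_cons_long // ext_rcons_long // subrr.
case: l m a cs => c q [d r] _ cs.
have [e|cd] := eqVneq c d.
  rewrite e /= -!actM mulrC subrr //.
rewrite (ext_head (@Ffree _) _ _ _ (leqnn _)) //; last by rewrite /alternating /= cd.
rewrite (ext_last (s := [:: _]) (@Ffree _) _ _ _ (leqnn _)) ?subrr //.
by rewrite /alternating /= eq_sym cd.
Qed.

(** A polynomial that is negligible in its own algebra is negligible in every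
    product: next to a letter of its colour it stays centred. *)
Lemma ext_null c q : (forall r, mean c (r * q) = 0) ->
  forall s, ext F (rcons s (c, q)) = 0.
Proof.
move=> z; have lw := letterwise_ctx [::] [:: (c, q)] (ext_letterwise F).
move=> s; rewrite -cats1; apply: (spanning lw) => {s} [|s s0 a cs].
  by rewrite -[q]mul1r; apply: z.
rewrite /= cats1; case: s s0 a cs => [//|[d r] [|m' s]] _ a cs; last first.
  by rewrite ext_rcons_long.
have [e|cd] := eqVneq c d.
  by rewrite e /= -actM -e; apply: z.
rewrite (ext_last (s := [:: _]) (@Ffree _) _ _ _ (leqnn _)) //.
by rewrite /alternating /= eq_sym cd.
Qed.

End FreeMoments.
End Functional.

(** * The Schwinger-Dyson equation and freeness *)

(** The sum of [G u * H v] over all factorizations [w = u c v]: it pairs [G] and [H]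
    with the free difference quotient of [w] in the variable [c]. *)
Fixpoint conv c G H (w : seq I) : K :=
  if w is d :: w' then (d == c)%:R * (G [::] * H w') + conv c (shift d G) H w'
  else 0.

Lemma conv_sum n c (k : 'I_n -> K) (G : 'I_n -> seq I -> K) H w :
  conv c (fun v => \sum_i k i * G i v) H w = \sum_i k i * conv c (G i) H w.
Proof.
elim: w G => [|d w IH] G /=; first by rewrite big1 // => i _; rewrite mulr0.
rewrite (IH (fun i => shift d (G i))) mulr_suml mulr_sumr -big_split /=.
by apply: eq_bigr => i _; rewrite mulrDr -mulrA mulrCA.
Qed.

Lemma conv_nseq c d G H i w : conv c G H (nseq i d ++ w) =
  (d == c)%:R * (\sum_(a < i) G (nseq a d) * H (nseq (i - a.+1) d ++ w)) +
  conv c (fun v => G (nseq i d ++ v)) H w.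
Proof.
elim: i G => [|i IH] G; first by rewrite big_ord0 mulr0 add0r.
rewrite /= IH big_ord_recl /= subn1 mulrDr addrA; congr (_ + _).
Qed.

Lemma act_conv c q G H w : act c q (conv c G H) w =
  conv c (act c q G) H w +
  \sum_(i < size q) q`_i *
     \sum_(a < i) G (nseq a c) * H (nseq (i - a.+1) c ++ w).
Proof.
rewrite /act conv_sum -big_split /=; apply: eq_bigr => i _.
by rewrite conv_nseq eqxx mul1r mulrDr addrC.
Qed.

Lemma act_conv_neq c d q G H w : d != c ->
  act d q (conv c G H) w = conv c (act d q G) H w.
Proof.
move=> /negbTE dc; rewrite /act conv_sum; apply: eq_bigr => i _.
by rewrite conv_nseq dc mul0r add0r.
Qed.

Lemma actXn c n F w : act c 'X^n F w = F (nseq n c ++ w).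
Proof.
rewrite /act size_polyXn big_ord_recr /= coefXn eqxx mul1r big1 ?add0r // => i _.
by rewrite coefXn ltn_eqF ?mul0r.
Qed.

Lemma actX c F : act c 'X F = shift c F.
Proof. by apply/funext => w; rewrite -['X]expr1 actXn. Qed.

(** The difference quotient is a derivation, so it splits one letter at a time, and
    splits a polynomial [q] into powers of total degree less than that of [q]. *)
Lemma ext_conv_eq0 c G H s :
  (forall s1 s2 q a b, s = s1 ++ (c, q) :: s2 -> ((a + b).+1 < size q)%N ->
     ext G (rcons s1 (c, 'X^a)) * ext H ((c, 'X^b) :: s2) = 0) ->
  ext (conv c G H) s = 0.
Proof.
elim: s G => [//|[d q] s IH] G z.
have z' : ext (conv c (act d q G) H) s = 0.
  apply: IH => s1 s2 r a b E ab.
  by rewrite -(z ((d, q) :: s1) s2 r a b) // E.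
have [e|dc] := eqVneq d c; last first.
  by rewrite -z' /=; congr ext; apply/funext => w; rewrite act_conv_neq.
rewrite e /= in z z' *.
transitivity (ext (fun w => conv c (act c q G) H w + \sum_(i < size q) q`_i *
     \sum_(a < i) G (nseq a c) * H (nseq (i - a.+1) c ++ w)) s).
  by congr ext; apply/funext => w; rewrite act_conv.
rewrite extD z' add0r ext_sum big1 // => i _.
rewrite ext_sum big1 ?mulr0 // => a _.
rewrite -(z [::] s q a (i - a.+1)%N) //; last by rewrite -addSn subnKC.
rewrite /= actXn cats0; congr (_ * ext _ _).
by apply/funext => w; rewrite actXn.
Qed.

Lemma ext_monomial F w : ext F [seq (d, 'X) | d <- w] = F w.
Proof. by elim: w F => [//|d w IH] F /=; rewrite actX IH. Qed.

(** Centring the first letter leaves an alternating product with centred head. *)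
Lemma free_moments2 F c d : F [::] = 1 -> free_moments F -> c != d ->
  F [:: c; d] = F [:: c] * F [:: d].
Proof.
move=> F1 Ffree cd; rewrite -!(ext_monomial F) /=.
have h : ext F (rcons [:: (c, center F c 'X)] (d, 'X)) = 0.
  apply: (ext_last F1 (@Ffree _)) => //; first by rewrite /alternating /= cd.
  by rewrite /centred /= mean_center // eqxx.
rewrite -[LHS]/(ext F ([::] ++ [:: (c, 'X); (d, 'X)])).
by rewrite (centerE F _ _ _ _ (ext_letterwise F)) [X in X + _]h add0r.
Qed.

Section SchwingerDyson.
Variables (F : seq I -> K) (c : I) (a l : K).
Hypothesis F1 : F [::] = 1.

(** The defect [S] of the equation is tested on alternating centred words.  On a
    single letter of colour [c] it is a combination of the defects of the moment
    recursion.  On any other word each term contains a product that vanishes by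
    freeness: a cut in the head letter leaves on its right, and any other cut leaves
    on its left, an alternating product in which only the outermost letter at the
    cut fails to be centred. *)
Lemma free_poisson_SD_ext : free_moments F ->
  (forall n, F (nseq n.+1 c) = a * (l * F (nseq n c) +
     \sum_(j < n) F (nseq j c) * F (nseq (n - j) c))) ->
  forall s, ext F ((c, 'X) :: s) =
            a * (l * ext F s + ext (conv c F (shift c F)) s).
Proof.
move=> Ffree rec s.
pose S w := - a * (l * F w + conv c F (shift c F) w) + shift c F w.
have extS t : ext S t = - a * (l * ext F t + ext (conv c F (shift c F)) t) +
    ext F ((c, 'X) :: t) by rewrite -ext_lin /= actX -ext_lin.
suff : ext S s = 0.
  by rewrite extS mulNr addrC => /eqP; rewrite subr_eq0 => /eqP.
apply: (spanning F1 (ext_letterwise S)) => {s}.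
  by rewrite /= /S /shift -[[:: c]]/(nseq 1 c) rec big_ord0 mulNr addNr.
case=> [//|[d q] s] _ alt cs.
have ce : centred F s by case/andP: cs.
have [[dc s1]|ns1] := pselect (d = c /\ s = [::]).
  rewrite dc s1 /= /act big1 // => i _; rewrite cats0.
  suff -> : S (nseq i c) = 0 by rewrite mulr0.
  rewrite /S /shift -[c :: _]/(nseq i.+1 c) rec -[X in conv _ _ _ X]cats0.
  rewrite conv_nseq eqxx mul1r addr0 mulNr.
  under eq_bigr => j _ do rewrite cats0 -[c :: _]/(nseq _.+1 c) subnSK //.
  exact: addNr.
have s0 : d = c -> s != [::] by move=> dc; apply/eqP => s0; apply: ns1.
rewrite extS (Ffree _ ((d, q) :: s) isT alt cs (leqnn _)) mulr0 add0r.
have -> : ext F [:: (c, 'X), (d, q) & s] = 0.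
  have [dc|dc] := eqVneq d c.
    by apply: ext_cons_long => //; case: (s) (s0 dc).
  by apply: (ext_head F1 (@Ffree _)) => //; rewrite /alternating /= eq_sym dc.
rewrite addr0 ext_conv_eq0 ?mulr0 // => s1 s2 r i j E _.
case: s1 E => [[dc _ s2E]|l1 s1 E].
  have -> : ext (shift c F) ((c, 'X^j) :: s2) = ext F ((c, 'X * 'X^j) :: s2).
    by rewrite /= actM actX.
  suff -> : ext F ((c, 'X * 'X^j) :: s2) = 0 by rewrite mulr0.
  rewrite -s2E; apply: (ext_head F1 (@Ffree _)) => //; first exact: s0.
  by move: alt; rewrite dc.
suff -> : ext F (rcons (l1 :: s1) (c, 'X^i)) = 0 by rewrite mul0r.
apply: (ext_last F1 (@Ffree _)) => //.
- by move: alt; rewrite E -cat_rcons => /alternating_cat[]; rewrite /alternating !map_rcons.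
- by move: cs; rewrite E /centred all_cat => /andP[].
Qed.

Lemma free_poisson_SD : free_moments F ->
  (forall n, F (nseq n.+1 c) = a * (l * F (nseq n c) +
     \sum_(j < n) F (nseq j c) * F (nseq (n - j) c))) ->
  forall w, F (c :: w) = a * (l * F w + conv c F (shift c F) w).
Proof.
move=> Ffree rec w; rewrite -(ext_monomial F w) -(ext_monomial (conv _ _ _)).
by rewrite -free_poisson_SD_ext // -(ext_monomial F).
Qed.

End SchwingerDyson.

Section Converse.
Variables (G : seq I -> K) (a : K) (theta : I -> K).
Hypothesis G1 : G [::] = 1.
Hypothesis SD : forall c w,
  G (c :: w) = a * (theta c * G w + conv c (shift c G) G w).

(** For a centred product with head [q = r 'X + k] in the variable [c], the equation
    rewrites the contribution of [r 'X] through products in which [r] replaces [q],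
    or a letter of colour [c] has been cut into pieces of smaller degree.  All
    have smaller total size, and in each pair at least one factor is alternating
    with centred interior. *)
Lemma SD_free : free_moments G.
Proof.
have lw := ext_letterwise G.
elim=> [|n IH] [//|[c q] s] _ alt cs; rewrite total_cons.
  rewrite leqn0 addn_eq0 size_poly_eq0 => /andP[/eqP-> _] /=.
  by rewrite -(ext0 s); congr ext; apply/funext => w; rewrite act0.
have [->|q0] := eqVneq q 0.
  by move=> _ /=; rewrite -[RHS](ext0 s); congr ext; apply/funext => w; rewrite act0.
have [s00|s0] := eqVneq s [::].
  by move: cs; rewrite s00 /centred /= andbT => /eqP.
have {}cs : centred G s by case/andP: cs.
have {IH} Gn : vanishing G n by exact: IH.
have alts := alternating_cons alt.
have altc r' : alternating ((c, r') :: s) by [].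
have [r [k qE]] : exists r (k : K), q = r * 'X + k%:P.
  elim/poly_ind: q {alt q0} => [|r k _]; last by exists r, k.
  by exists 0, 0; rewrite mul0r addr0.
move: q0; rewrite -size_poly_gt0 => q0 sn.
have Gs : ext G s = 0.
  by apply: Gn => //; rewrite -ltnS (leq_trans _ sn) // -add1n leq_add2r.
rewrite qE -[ext _ _]/(ext G ([::] ++ _)) lw.1 /= Gs mulr0 addr0 actMX.
have [->|r0] := eqVneq r 0.
  by rewrite -[RHS](ext0 s); congr ext; apply/funext => w; rewrite act0.
have szq : size q = (size r).+1.
  by rewrite qE size_MXaddC (negbTE r0).
have szr : size (r * 'X) = (size r).+1 by rewrite size_mulX.
rewrite szq addSn ltnS in sn.
have -> : shift c G = fun w => a * (theta c * G w + conv c (shift c G) G w).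
  by apply/funext => w; rewrite -SD.
rewrite -[ext _ _]/(ext _ ((c, r) :: s)) extZ ext_lin.
rewrite (ext_head G1 Gn s0 (altc r) cs) // mulr0 add0r.
rewrite ext_conv_eq0 ?mulr0 // => s1 s2 q' i j E ij.
(* a cut in the head letter: the right factor starts with a power of [c] *)
case: s1 E => [[qq' s2E]|l1 s1 [l1E sE]].
  rewrite -s2E; suff -> : ext G ((c, 'X^j) :: s) = 0 by rewrite mulr0.
  apply: (ext_head G1 Gn) => //; rewrite total_cons size_polyXn.
  rewrite (leq_trans _ sn) // leq_add2r qq' (leq_trans _ ij) //.
  by rewrite ltnS ltnW // ltnS leq_addl.
rewrite sE total_cat total_cons in sn.
have s10 : s1 != [::].
  apply/eqP => s10; move: (altc r); rewrite sE s10 /alternating /= eqxx.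
  by [].
(* a cut in the last letter leaves no centred letter on the right, so the left
   factor has to vanish; in all other cases the right factor does *)
rewrite -l1E; have [s20|s20] := eqVneq s2 [::].
  suff H : ext G ((c, r * 'X) :: rcons s1 (c, 'X^i)) = 0.
    by rewrite -[RHS](mul0r (ext G ((c, 'X^j) :: s2))) -H /= actMX.
  apply: (ext_both G1 Gn) => //.
  - move: (altc r); rewrite sE s20 cats1 /alternating /= !map_rcons.
    by [].
  - by move: cs; rewrite sE /centred all_cat => /andP[].
  - rewrite total_cons total_rcons szr size_polyXn (leq_trans _ sn) //.
    rewrite s20 /= addn0 addSn -addnS leq_add2l -addnS leq_add2l.
    by rewrite (leq_trans _ ij) // !ltnS leq_addr.
suff -> : ext G ((c, 'X^j) :: s2) = 0 by rewrite mulr0.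
apply: (ext_head G1 Gn) => //.
- by move: alts; rewrite sE => /alternating_cat[].
- by move: cs; rewrite sE /centred all_cat /= => /and3P[].
rewrite total_cons size_polyXn (leq_trans _ sn) // !addnA leq_add2r.
rewrite (leq_trans _ (leq_addl _ _)) //.
by rewrite (leq_trans _ ij) // ltnS ltnW // ltnS leq_addl.
Qed.

End Converse.

End Words.

(** * Compression of a free Poisson element by orthogonal projections *)

Section Compression.
Variables (K : comNzRingType) (I J : eqType).
Local Notation letter := (I * {poly K})%type.
Implicit Types (q r u : {poly K}) (s t : seq letter).
Variables (F : seq I -> K) (c e : I) (a : K) (beta : J -> {poly K}).
Hypothesis F1 : F [::] = 1.
Hypothesis Ffree : free_moments F.
Hypothesis ec : e != c.
Hypothesis SD : forall s,
  ext F ((c, 'X) :: s) = a * (ext F s + ext (conv c F (shift c F)) s).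
Hypothesis beta_orth : forall i j r,
  mean F e (r * (beta i * beta j)) = (i == j)%:R * mean F e (r * beta i).

(** The word [w] in the elements [x_i = c * beta_i(e)]. *)
Definition compressed_word (w : seq J) : seq letter :=
  flatten [seq [:: (c, 'X); (e, beta i)] | i <- w].

Definition compressed (w : seq J) : K := ext F (compressed_word w).
Local Notation G := compressed.

Lemma ext_rot s t : ext F (s ++ t) = ext F (t ++ s).
Proof.
elim: s t => [|l s IH] t; first by rewrite cats0.
by rewrite cat_cons (ext_trace F1 Ffree) -cats1 -catA IH -catA.
Qed.

Lemma ext_rconsD H s d q r :
  ext H (rcons s (d, q + r)) = ext H (rcons s (d, q)) + ext H (rcons s (d, r)).
Proof. by elim: s H => [|l s IH] H /=; rewrite ?actD ?IH. Qed.

(** The difference of the two last letters is negligible in the sense of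
    [ext_null]. *)
Lemma ext_last_mean s d q r :
  (forall u, mean F d (u * q) = mean F d (u * r)) ->
  ext F (rcons s (d, q)) = ext F (rcons s (d, r)).
Proof.
move=> qr; rewrite -[q](subrK r) ext_rconsD (ext_null F1 Ffree) ?add0r // => u.
have := qr u; rewrite -[q in mean _ _ (u * q)](subrK r) mulrDr meanD => /eqP.
by rewrite -subr_eq0 addrK => /eqP.
Qed.

Lemma compressed_word_rcons w i :
  compressed_word (rcons w i) =
  rcons (rcons (compressed_word w) (c, 'X)) (e, beta i).
Proof.
by rewrite /compressed_word map_rcons flatten_rcons -!cats1 -catA.
Qed.

(** The functional [beta_i(e) * w], which the equation for [c] produces. *)
Definition prefixed (i : J) (w : seq J) : K :=
  ext F ((e, beta i) :: compressed_word w).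

(** By traciality [beta_i] meets the [beta_j] of the last factor, and these are
    orthogonal projections. *)
Lemma prefixed_rcons i w j :
  prefixed i (rcons w j) = (i == j)%:R * G (rcons w j).
Proof.
rewrite /prefixed (ext_trace F1 Ffree) /G compressed_word_rcons.
rewrite -[in LHS]cats1 cat_rcons.
rewrite (ext_letterwise F).2 cats1.
have [->|ij] := eqVneq i j.
  by rewrite mul1r; apply: ext_last_mean => u; rewrite beta_orth eqxx mul1r.
rewrite mul0r; apply: (ext_null F1 Ffree) => u.
by rewrite beta_orth eq_sym (negbTE ij) mul0r.
Qed.

(** Each letter of [w] contains exactly one [c], at its start; cutting there gives
    all factorizations [w = u v] with [v] nonempty. *)
Fixpoint cut (H : seq J -> K) (w : seq J) : K :=
  if w is i :: w' then H [::] * G w + cut (fun v => H (i :: v)) w' else 0.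

Lemma ext_conv_compressed H w :
  ext (conv c H (shift c F)) (compressed_word w) =
  cut (fun v => ext H (compressed_word v)) w.
Proof.
elim: w H => [//|i w IH] H.
have -> : ext (conv c H (shift c F)) (compressed_word (i :: w)) =
  H [::] * G (i :: w) +
  ext (conv c (act e (beta i) (shift c H)) (shift c F)) (compressed_word w).
  rewrite /G /= actX -ext_lin; congr ext; apply/funext => v.
  rewrite -act_conv_neq // -act_lin actX; congr (act _ _ _ v).
  by apply/funext => u; rewrite {1}/shift /= eqxx mul1r.
by rewrite IH /= actX.
Qed.

Lemma compressed1 : G [::] = 1. Proof. exact: F1. Qed.

(** The term [H w] is the missing factorization with [v] empty; grouping by the
    last letter of a nonempty [u] turns cuts before a letter into cuts after
    one. *)
Lemma cut_last (i : J) (H M : seq J -> K) w :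
  (forall v j, H (rcons v j) = (i == j)%:R * M (rcons v j)) ->
  H w + cut H w = H [::] * G w + conv i (fun v => M (rcons v i)) G w.
Proof.
elim: w H M => [|j w IH] H M HM /=; first by rewrite addr0 compressed1 mulr1 addr0.
rewrite addrCA; congr (_ + _).
rewrite (IH _ (fun v => M (j :: v))); last by move=> v k; rewrite -rcons_cons HM.
rewrite -[H [:: j]]/(H (rcons [::] j)) HM /= mulrA; congr (_ * _ + _).
by have [->|_] := eqVneq i j; rewrite ?mul0r.
Qed.

Lemma compressed_SD i w :
  G (i :: w) = a * (mean F e (beta i) * G w + conv i (shift i G) G w).
Proof.
rewrite {1}/G -[compressed_word _]/((c, 'X) :: (e, beta i) :: compressed_word w).
rewrite SD; congr (_ * _).
have -> : ext (conv c F (shift c F)) ((e, beta i) :: compressed_word w) =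
    cut (prefixed i) w.
  rewrite -ext_conv_compressed /=; congr ext; apply/funext => v.
  by rewrite act_conv_neq.
rewrite -[X in X + _]/(prefixed i w) (cut_last _ (@prefixed_rcons i)).
congr (_ + conv i _ G w); apply/funext => v.
rewrite /shift /G compressed_word_rcons -!cats1 -catA /=.
exact: (ext_rot _ [:: _; _]).
Qed.

Lemma compressed_free : free_moments G.
Proof. exact: (SD_free compressed1 compressed_SD). Qed.

Lemma compressed_nseq i n :
  G (nseq n.+1 i) = a * (mean F e (beta i) * G (nseq n i) +
    \sum_(j < n) G (nseq j i) * G (nseq (n - j) i)).
Proof.
rewrite -[nseq _.+1 _]/(i :: nseq n i) compressed_SD.
rewrite -[X in conv _ _ _ X]cats0 conv_nseq eqxx mul1r addr0.
congr (_ * (_ + _)); rewrite (reindex_inj rev_ord_inj) /=.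
apply: eq_bigr => j _; rewrite cats0 mulrC /shift.
rewrite -[i :: nseq _ _]/(nseq _.+1 i) subnSK //.
by rewrite subKn // ltnW.
Qed.

End Compression.

(** * Words in the elements of an algebra *)

Section Moments.
Variables (R : realType) (A : algType R[i]) (phi : {scalar A}) (I : eqType).
Variable (x : I -> A).
Local Notation letter := (I * {poly R[i]})%type.

Definition moment (w : seq I) : R[i] := phi (\prod_(c <- w) x c).

Definition eval_letter (l : letter) : A := horner_alg (x l.1) l.2.

Lemma act_moment c q (u : A) :
  act c q (fun w => phi (u * \prod_(d <- w) x d)) =
  fun w => phi (u * horner_alg (x c) q * \prod_(d <- w) x d).
Proof.
elim/poly_ind: q u => [|q k IH] u; apply/funext => w.
  by rewrite act0 rmorph0 mulr0 mul0r linear0.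
rewrite actD actC actMX rmorphD rmorphM /= horner_algX horner_algC.
have -> : shift c (fun w => phi (u * \prod_(d <- w) x d)) =
    fun w => phi (u * x c * \prod_(d <- w) x d).
  by apply/funext => v; rewrite /shift big_cons mulrA.
rewrite IH mulrDr mulrDl linearD /=; congr (phi _ + _).
  have := congr1 (horner_alg (x c)) (mulrC 'X q).
  by rewrite !rmorphM /= horner_algX -!mulrA => comm; rewrite [in LHS](mulrA (x c)) comm -mulrA.
by rewrite -scalerAr -scalerAl mulr1 linearZ.
Qed.

Lemma ext_moment (s : seq letter) :
  ext moment s = phi (\prod_(l <- s) eval_letter l).
Proof.
suff H u : ext (fun w => phi (u * \prod_(d <- w) x d)) s =
    phi (u * \prod_(l <- s) eval_letter l).
  rewrite -[RHS](congr1 phi (mul1r _)) -H; congr ext.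
  by apply/funext => w; rewrite mul1r.
elim: s u => [|[c q] s IH] u; first by rewrite /= !big_nil.
by rewrite /= act_moment IH big_cons mulrA.
Qed.

Lemma gen_subalgebraP (y z : A) :
  gen_subalgebra [set y] z <-> exists q, z = horner_alg y q.
Proof.
split=> [|[q ->]].
  move=> h; apply: (h (fun u => exists q, u = horner_alg y q)).
  split; last by move=> _ ->; exists 'X; rewrite horner_algX.
  split; first by apply/mem_set; exists 1; rewrite rmorph1.
    move=> k u v /set_mem[q ->] /set_mem[r ->]; apply/mem_set.
    exists (k *: q + r).
  by rewrite rmorphD -mul_polyC rmorphM /= horner_algC mulr_algl.
  move=> u v /set_mem[q ->] /set_mem[r ->]; apply/mem_set.
  by exists (q * r); rewrite rmorphM.
have [g1 gl gm] := gen_subalgebra_closed [set y].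
have yg : y \in gen_subalgebra [set y].
  by apply/mem_set => B [_]; apply.
have g0 : 0 \in gen_subalgebra [set y].
  by rewrite -[0](addNr 1) -scaleN1r; apply: gl.
apply/set_mem; elim/poly_ind: q => [|q k IH]; first by rewrite rmorph0.
rewrite rmorphD rmorphM /= horner_algX horner_algC addrC.
by apply: gl => //; apply: gm.
Qed.

(** The subalgebra generated by one element consists of the polynomials in it, so
    freeness of elements is a property of their joint moments. *)
Lemma free_elementsP : free_elements phi x <-> free_moments moment.
Proof.
split=> [fr n s s0 alt cs _|fm].
  rewrite ext_moment big_tnth.
  apply: (fr (size s) (fun j => (tnth (in_tuple s) j).1)).
  - by rewrite lt0n size_eq0.
  - move=> j; apply/mem_set/gen_subalgebraP; by exists (tnth (in_tuple s) j).2.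
  - move=> j; have /allP/(_ _ (mem_tnth j (in_tuple s)))/eqP := cs.
    by rewrite /mean ext_moment big_seq1.
  - case: s s0 alt cs => // l0 s _ alt _ j j' jj'.
    rewrite !(tnth_nth l0) /= jj'.
    have sj : (j.+1 < size (l0 :: s))%N by rewrite -jj'; exact: (ltn_ord j').
    have /(sortedP l0.1)/(_ j) := alt; rewrite size_map => /(_ sj).
    have sj' : (j < size (l0 :: s))%N := ltnW sj.
    by rewrite !(nth_map l0) // => /eqP.
move=> k i a k0 ag a0 alt.
have /choice[q qE] : forall j, exists q, a j = horner_alg (x (i j)) q.
  by move=> j; apply/gen_subalgebraP/set_mem/ag.
have -> : \prod_(j < k) a j =
    \prod_(l <- [seq (i j, q j) | j <- enum 'I_k]) eval_letter l.
  rewrite big_map enumT -[Finite.enum _]/(index_enum _).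
  by apply: eq_bigr => j _; rewrite qE.
rewrite -ext_moment; apply: fm (leqnn _).
- by rewrite -size_eq0 size_map size_enum_ord -lt0n.
- case: k i a k0 ag a0 alt q qE => // k i a k0 ag a0 alt q qE.
  rewrite /alternating -map_comp; apply/(sortedP (i ord0)) => n.
  rewrite size_map size_enum_ord => nk.
  have nk' := ltnW nk.
  rewrite (nth_map ord0) ?size_enum_ord // (nth_map ord0) ?size_enum_ord //=.
  by apply/eqP/alt; rewrite !nth_enum_ord.
- apply/allP => _ /mapP[j _ ->] /=.
  by rewrite /mean ext_moment big_seq1 /eval_letter -qE a0.
Qed.

End Moments.

Lemma moment_nseq (R : realType) (A : algType R[i]) (phi : {scalar A})
    (I : eqType) (x : I -> A) n c :
  moment phi x (nseq n c) = phi (x c ^+ n).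
Proof.
congr (phi _); elim: n => [|n IH]; first by rewrite big_nil.
by rewrite big_cons IH exprS.
Qed.

(** The law of [b] is the measure with mass [p] at 1 and [1 - p] at 0. *)
Lemma bernoulli_horner (R : realType) (A : algType R[i]) (phi : {scalar A})
    (b : A) (p : R) (q : {poly R[i]}) : phi 1 = 1 -> bernoulli phi b p ->
  phi (horner_alg b q) = p%:C * q.[1] + (1 - p%:C) * q.[0].
Proof.
move=> phi1 bB.
transitivity (ext (moment phi (fun=> b)) [:: (tt, q)]).
  by rewrite ext_moment big_seq1.
rewrite /= /act.
under eq_bigr => i _ do rewrite cats0 moment_nseq.
have bn i : phi (b ^+ i) = p%:C + (1 - p%:C) * (i == 0%N)%:R.
  case: i => [|i]; first by rewrite expr0 phi1 mulr1 addrC subrK.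
  by rewrite mulr0 addr0; apply: bB.2.
under eq_bigr => i _ do rewrite bn mulrDr.
rewrite big_split /= -mulr_suml mulrC horner_coef; congr (_ * _ + _).
  by apply: eq_bigr => i _; rewrite expr1n mulr1.
under eq_bigr => i _ do rewrite mulrCA.
rewrite -mulr_sumr horner_coef; congr (_ * _).
by apply: eq_bigr => i _; rewrite expr0n.
Qed.

Lemma bernoulli_compl (R : realType) (A : algType R[i]) (phi : {scalar A})
    (b : A) (p : R) : phi 1 = 1 -> bernoulli phi b p -> bernoulli phi (1 - b) (1 - p).
Proof.
move=> phi1 bB; case: (bB) => /andP[p0 p1] _; split.
  by rewrite subr_ge0 p1 lerBlDr lerDl p0.
case=> // n _.
have -> : (1 - b) ^+ n.+1 = horner_alg b ((1 - 'X) ^+ n.+1).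
  by rewrite rmorphXn rmorphB /= horner_algX rmorph1.
rewrite (bernoulli_horner _ phi1 bB) !hornerE subrr subr0 expr0n expr1n.
by rewrite mulr0 add0r mulr1 rmorphB rmorph1.
Qed.

Lemma freely_independent_compl (R : realType) (A : algType R[i]) (phi : {scalar A}) (x b : A) :
  freely_independent phi x b -> freely_independent phi x (1 - b).
Proof.
move=> fr k i a k0 ag a0 alt; apply: (fr k i) => // j.
have := ag j; case: (i j) => // /set_mem/gen_subalgebraP[q ->].
apply/mem_set/gen_subalgebraP; exists (q \Po (1 - 'X)).
elim/poly_ind: q => [|q c IH]; first by rewrite comp_poly0 !rmorph0.
rewrite comp_polyD comp_polyM comp_polyX comp_polyC.
by rewrite !rmorphD !rmorphM /= IH rmorphB /= !horner_algX !horner_algC scale1r.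
Qed.

(** * The pair of a free Poisson and a Bernoulli element *)

Section PoissonBernoulli.
Variables (R : realType) (A : algType R[i]) (phi : {scalar A}).
Hypothesis phi1 : phi 1 = 1.
Variables (fp b : A) (lambda alpha p : R).
Hypothesis fpP : free_poisson phi fp lambda alpha.
Hypothesis bB : bernoulli phi b p.
Hypothesis fpb : freely_independent phi fp b.

Local Notation pair := (fun i : bool => if i then fp else b).
Local Notation F := (moment phi pair).
Local Notation a := (alpha%:C).
Local Notation l := (lambda%:C).
Local Notation P := (p%:C).

Let F1 : F [::] = 1. Proof. by rewrite /moment big_nil. Qed.

Let Ffree : free_moments F. Proof. exact/free_elementsP. Qed.

Let Frec n : F (nseq n.+1 true) = a * (l * F (nseq n true) +
  \sum_(j < n) F (nseq j true) * F (nseq (n - j) true)).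
Proof.
rewrite !moment_nseq (free_poisson_moment_rec phi1 _ fpP).
by congr (_ * (_ + _)); apply: eq_bigr => j _; rewrite !moment_nseq.
Qed.

Let SD w : F (true :: w) = a * (l * F w + conv true F (shift true F) w).
Proof. exact: free_poisson_SD. Qed.

Let bernoulli_mean q : mean F false q = P * q.[1] + (1 - P) * q.[0].
Proof.
by rewrite /mean ext_moment big_seq1 (bernoulli_horner _ phi1 bB).
Qed.

Definition corner (i : bool) : {poly R[i]} := if i then 'X else 1 - 'X.

Lemma corner_orth i j r : mean F false (r * (corner i * corner j)) =
  (i == j)%:R * mean F false (r * corner i).
Proof.
rewrite !bernoulli_mean !hornerM.
by case: i; case: j; rewrite !(hornerE, eqxx) /=; ring.
Qed.

Lemma corner_mean i : mean F false (corner i) = if i then P else 1 - P.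
Proof. by rewrite bernoulli_mean; case: i; rewrite !hornerE; ring. Qed.

Lemma moment_compressed :
  moment phi (fun i : bool => if i then fp * b else fp * (1 - b)) =
  compressed F true false corner.
Proof.
apply/funext => w; rewrite /compressed ext_moment; congr (phi _).
elim: w => [|i w IH]; first by rewrite !big_nil.
rewrite big_cons IH /= !big_cons mulrA; congr (_ * _).
rewrite /eval_letter /= horner_algX; case: i => /=.
  by rewrite horner_algX.
by rewrite rmorphB /= horner_algX rmorph1.
Qed.

Section RateOne.
Hypothesis l1 : lambda = 1.

Let SD1 s : ext F ((true, 'X) :: s) =
  a * (ext F s + ext (conv true F (shift true F)) s).
Proof. by rewrite (free_poisson_SD_ext F1 Ffree Frec) l1 mul1r. Qed.

Lemma compressed_freely_independent : freely_independent phi (fp * b) (fp * (1 - b)).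
Proof.
apply/free_elementsP; rewrite moment_compressed.
exact: (compressed_free F1 Ffree _ SD1 corner_orth).
Qed.

Lemma compressed_free_poisson (i : bool) :
  0 < p < 1 -> free_poisson phi (if i then fp * b else fp * (1 - b))
    (if i then p else 1 - p) alpha.
Proof.
move=> /andP[p0 p1]; case: (fpP) => _ a0 _.
apply: moment_rec_free_poisson => //.
  by case: i; rewrite // subr_gt0.
have mG n : phi ((if i then fp * b else fp * (1 - b)) ^+ n) =
    compressed F true false corner (nseq n i).
  by rewrite -moment_compressed moment_nseq.
move=> n; rewrite !mG (compressed_nseq F1 Ffree _ SD1 corner_orth) // corner_mean.
congr (_ * (_ * _ + _)).
  by case: (i); rewrite // rmorphB rmorph1.
by apply: eq_bigr => j _; rewrite !mG.
Qed.

End RateOne.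

Let trace c w : F (c :: w) = F (rcons w c).
Proof.
by rewrite -(ext_monomial F) [LHS](ext_trace F1 Ffree) -map_rcons ext_monomial.
Qed.

Let Fb n : F (nseq n.+1 false) = P.
Proof. by rewrite moment_nseq; apply: bB.2. Qed.

Let Fpb n : F (true :: nseq n.+1 false) = a * (l * P).
Proof.
rewrite SD Fb; congr (_ * _); rewrite -[X in conv _ _ _ X]cats0 conv_nseq.
by rewrite mul0r !addr0.
Qed.

Let Fpbpb : F [:: true; false; true; false] = a * (l + P) * (a * (l * P)).
Proof.
rewrite SD (trace false) /= /shift (Fb 0) (Fpb 1) (Fpb 0) mul0r mul1r.
ring.
Qed.

Let Fpbpbb : F [:: true; false; true; false; false] =
  a * (l + P) * (a * (l * P)).
Proof.
rewrite SD (trace false) /= /shift (Fb 0) (Fpb 2) (Fpb 1) !mul0r mul1r.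
ring.
Qed.

Let Fpbpbpb : F [:: true; false; true; false; true; false] =
  a * (l + P) * (a * (l + P) * (a * (l * P))) + a * (a * (l * P)) ^+ 2.
Proof.
rewrite SD (trace false) /= /shift Fpbpbb (Fb 0) Fpbpb.
rewrite !mul0r (trace false) /= (Fpb 1) (Fpb 0) !mul1r.
ring.
Qed.

Let moment_pb n : phi ((fp * b) ^+ n) = F (flatten (nseq n [:: true; false])).
Proof.
congr (phi _); elim: n => [|n IH]; first by rewrite big_nil.
by rewrite /= !big_cons -IH exprS mulrA.
Qed.

Hypothesis p01 : 0 < p < 1.
Hypothesis l1 : lambda <> 1.

Let aC : a != 0.
Proof. by case: (fpP) => _ a0 _; rewrite fmorph_eq0 gt_eqF. Qed.
Let lC : l != 0.
Proof. by case: (fpP) => l0 _ _; rewrite fmorph_eq0 gt_eqF. Qed.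
Let PC : P != 0.
Proof. by case/andP: p01 => p0 _; rewrite fmorph_eq0 gt_eqF. Qed.
Let P1C : 1 - P != 0.
Proof.
case/andP: p01 => _ p1; rewrite -(rmorph1 (@real_complex R)) -rmorphB fmorph_eq0.
by rewrite subr_eq0 eq_sym lt_eqF.
Qed.
Let l1C : 1 - l != 0.
Proof.
rewrite -(rmorph1 (@real_complex R)) -rmorphB fmorph_eq0.
by rewrite subr_eq0 eq_sym; apply/eqP.
Qed.

(** Comparing the first three moments with the recursion of a free Poisson element
    gives [beta * (mu + 1) = alpha * (lambda + p)], then [beta = alpha], and
    finally [(1 - lambda) * (1 - p) = 0]. *)
Lemma compressed_not_free_poisson mu beta : ~ free_poisson phi (fp * b) mu beta.
Proof.
move=> H.
have e1 := free_poisson_moment_rec phi1 0 H.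
have e2 := free_poisson_moment_rec phi1 1 H.
have e3 := free_poisson_moment_rec phi1 2 H.
rewrite !big_ord_recl !big_ord0 /= !moment_pb /= F1 (Fpb 0) ?Fpbpb ?Fpbpbpb in e1 e2 e3.
set M := mu%:C in e1 e2 e3; set B := beta%:C in e1 e2 e3.
have m0 : a * (l * P) != 0 by rewrite !mulf_neq0.
set m := a * (l * P) in e1 e2 e3 m0.
have h1 : B * M = m by rewrite e1; ring.
have h2 : B * (M + 1) = a * (l + P).
  by apply: (mulIf m0); rewrite e2; ring.
have h3 : B = a.
  have : a * (l + P) * (a * (l + P) * m) + a * m ^+ 2 =
      B * (M + 1) * (a * (l + P) * m) + B * m ^+ 2 by rewrite e3; ring.
  by rewrite h2 => /addrI/(mulIf (expf_neq0 2 m0)).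
rewrite h3 in h1 h2.
have : a * ((1 - l) * (1 - P)) = 0.
  transitivity (a * (M + 1) - a * (l + P) - (a * M - m)); last first.
    by rewrite h1 h2 !subrr.
  rewrite /m; ring.
by move/eqP; rewrite !mulf_eq0 (negbTE aC) (negbTE l1C) (negbTE P1C).
Qed.

(** Freeness would make the mixed second moment the product of the means; their
    difference is [alpha ^ 2 * lambda * p * (1 - p) * (1 - lambda)]. *)
Lemma compressed_not_freely_independent :
  ~ freely_independent phi (fp * b) (fp * (1 - b)).
Proof.
move=> /free_elementsP fr.
have y1 : moment phi (fun i : bool => if i then fp * b else fp * (1 - b)) [::] = 1.
  by rewrite /moment big_nil.
have := free_moments2 y1 fr (isT : true != false).
have E1 : phi (fp * b) = a * (l * P).
  by rewrite -(Fpb 0) /moment !big_cons big_nil mulr1.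
have E2 : phi fp = a * l.
  by have := SD [::]; rewrite /moment !big_cons big_nil mulr1 phi1 /= addr0 mulr1.
have E3 : phi (fp * b * fp) = a * (l * (a * (l * P)) + P * (a * l)).
  transitivity (F [:: true; false; true]).
    by rewrite /moment !big_cons big_nil mulr1 mulrA.
  rewrite SD (trace false) /= (Fpb 0) /shift (Fb 0) !mul0r mul1r.
  by rewrite {1}/moment big_cons big_nil mulr1 E2; ring.
have E4 : phi (fp * b * (fp * b)) = a * (l + P) * (a * (l * P)).
  by rewrite -Fpbpb /moment !big_cons big_nil mulr1 !mulrA.
rewrite /moment !big_cons !big_nil !mulr1 /=.
rewrite !mulrBr !mulr1 !linearB /= mulrBr E1 E2 E4 mulrA E3 => e.
have : a ^+ 2 * l * P * ((1 - l) * (1 - P)) = 0.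
  move/eqP: e; rewrite -subr_eq0 => /eqP e; rewrite -[RHS]e; ring.
move/eqP; rewrite !mulf_eq0 (negbTE l1C) (negbTE P1C) (negbTE PC) (negbTE lC).
by rewrite (negbTE aC).
Qed.

End PoissonBernoulli.

Theorem proposition3p2 (R : realType) (A : algType R[i]) (phi : {scalar A})
    (phi1 : phi 1 = 1) (fp b : A) (lambda alpha p : R)
    (hp : 0 < p < 1)
    (fpP : free_poisson phi fp lambda alpha)
    (bB : bernoulli phi b p)
    (fpb : freely_independent phi fp b) :
  (lambda = 1 ->
     [/\ freely_independent phi (fp * b) (fp * (1 - b)),
         free_poisson_rate phi (fp * b) p &
         free_poisson_rate phi (fp * (1 - b)) (1 - p)]) /\
  (lambda <> 1 ->
     [/\ forall mu beta : R, ~ free_poisson phi (fp * b) mu beta,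
         forall mu beta : R, ~ free_poisson phi (fp * (1 - b)) mu beta &
         ~ freely_independent phi (fp * b) (fp * (1 - b))]).
Proof.
split=> l1.
  split.
  - exact: (compressed_freely_independent phi1 fpP bB fpb).
  - exists alpha; exact: (compressed_free_poisson phi1 fpP bB fpb l1 true).
  - exists alpha; exact: (compressed_free_poisson phi1 fpP bB fpb l1 false).
split.
- exact: (compressed_not_free_poisson phi1 fpP bB fpb).
- have q01 : 0 < 1 - p < 1.
    by case/andP: hp => p0 p1; rewrite subr_gt0 p1 ltrBlDr ltrDl.
  exact: (compressed_not_free_poisson phi1 fpP (bernoulli_compl phi1 bB)
    (freely_independent_compl fpb) q01 l1).
- exact: (compressed_not_freely_independent phi1 fpP bB fpb).
Qed.
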